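(* Suppose $p>n$, $n\ge 2$, and $u\in\mathcal{D}^{1,p}(\mathbb{R}^n)$ is the Morrey extremal which satisfies $$\sup_{x\neq y}\left\{\frac{|u(x)-u(y)|}{|x-y|^{1-n/p}}\right\}=\frac{|u(e_n)-u(-e_n)|}{|e_n-(-e_n)|^{1-n/p}},\qquad u(e_n)=1,\qquad u(-e_n)=-1.$$ Then $$u(Ox)=u(x),\quad x\in\mathbb{R}^n,$$ for each orthogonal transformation $O:\mathbb{R}^n\to\mathbb{R}^n$ with $Oe_n=e_n$. Moreover, $$u(Tx)=-u(x),\quad x\in\mathbb{R}^n,$$ where $Tx=x-2x_ne_n$.
   Context: $\mathcal{D}^{1,p}(\mathbb{R}^n)$ is the space of weakly differentiable functions $u:\mathbb{R}^n\to\mathbb{R}$ whose first-order weak partial derivatives $u_{x_1},\dots,u_{x_n}$ belong to $L^p(\mathbb{R}^n)$; $Du$ is the weak gradient. Since $p>n$, each such $u$ agrees a.e. with a Hölder continuous function of exponent $1-n/p$, and $u$ is always identified with this continuous representative. $e_n\in\mathbb{R}^n$ is the point with $1$ in its $n$th coordinate and $0$ otherwise. Morrey's inequality states that there is a constant $C$ with $$\sup_{x\neq y}\left\{\frac{|v(x)-v(y)|}{|x-y|^{1-n/p}}\right\}\le C\left(\int_{\mathbb{R}^n}|Dv|^p\,dx\right)^{1/p}\quad\text{for all } v\in\mathcal{D}^{1,p}(\mathbb{R}^n).$$ There is a smallest such constant $C_*>0$. A Morrey extremal is a nonconstant $u\in\mathcal{D}^{1,p}(\mathbb{R}^n)$ for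 which equality holds in Morrey's inequality with $C=C_*$. It is known (from earlier work) that a Morrey extremal satisfying the normalization in the claim exists and is unique, which is the reason for the word ''the''. *)

(* Defs.v *)
From HB Require Import structures.
From mathcomp Require Import all_boot all_order all_algebra.
From mathcomp Require Import all_classical all_reals all_analysis.

Set Implicit Arguments.
Unset Strict Implicit.
Unset Printing Implicit Defensive.

Import Order.TTheory GRing.Theory Num.Theory.
Import numFieldNormedType.Exports.

Local Open Scope classical_set_scope.
Local Open Scope ring_scope.

(* 'rV[R]_n carries the product sigma-algebra, generated by the coordinates;
   this is the construction of the library for n.-tuple R. *)
Section measurable_rV.
Context {R : realType} (n : nat).

Let coord (i : 'I_n) (x : 'rV[R]_n) : R := x ord0 i.

Let rV_set0 : g_sigma_preimage coord set0.
Proof. exact: sigma_algebra0. Qed.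

Let rV_setC A : g_sigma_preimage coord A -> g_sigma_preimage coord (~` A).
Proof. exact: sigma_algebraC. Qed.

Let rV_bigcup (F : _^nat) : (forall i, g_sigma_preimage coord (F i)) ->
  g_sigma_preimage coord (\bigcup_i (F i)).
Proof. exact: sigma_algebra_bigcup. Qed.

HB.instance Definition _ :=
  @isMeasurable.Build (measure_tuple_display default_measure_display)
    'rV[R]_n (g_sigma_preimage coord) rV_set0 rV_setC rV_bigcup.

End measurable_rV.

Section measurable_rV_theory.
Context {R : realType}.

Lemma measurable_coord n (i : 'I_n) :
  measurable_fun [set: 'rV[R]_n] (fun x : 'rV[R]_n => x ord0 i).
Proof.
move=> _ Y mY; rewrite setTI; apply: sub_sigma_algebra => /=.
rewrite -bigcup_seq/=; exists i => /=; first by rewrite mem_index_enum.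
by exists Y => //; rewrite setTI.
Qed.

Lemma measurable_fun_rV d (T : measurableType d) n (f : T -> 'rV[R]_n) :
  (forall i, measurable_fun [set: T] (fun t => f t ord0 i)) ->
  measurable_fun [set: T] f.
Proof.
move=> mf _ A mA; rewrite setTI.
suff : g_sigma_preimage (fun (i : 'I_n) (x : 'rV[R]_n) => x ord0 i) `<=`
    image_set_system setT f measurable.
  by move=> /(_ A mA); rewrite /image_set_system/= setTI.
apply: smallest_sub.
  by apply: sigma_algebra_image; exact: sigma_algebra_measurable.
rewrite -bigcup_seq; apply: bigcup_sub => i _ B [C mC <-].
by rewrite /image_set_system/= !setTI; have := mf i measurableT C mC;
  rewrite setTI.
Qed.

Definition rV_cons n (z : R * 'rV[R]_n) : 'rV[R]_n.+1 :=
  row_mx (z.1)%:M z.2.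

Definition rV_uncons n (x : 'rV[R]_n.+1) : R * 'rV[R]_n :=
  (x ord0 ord0, \row_j x ord0 (lift ord0 j)).

Lemma rV_cons0 n (z : R * 'rV[R]_n) : rV_cons z ord0 ord0 = z.1.
Proof.
rewrite /rV_cons (_ : ord0 = lshift n (ord0 : 'I_1)); last exact/val_inj.
by rewrite (row_mxEl z.1%:M z.2) mxE eqxx mulr1n.
Qed.

Lemma rV_cons_lift n (z : R * 'rV[R]_n) j :
  rV_cons z ord0 (lift ord0 j) = z.2 ord0 j.
Proof.
rewrite /rV_cons (_ : lift ord0 j = rshift 1 j); last exact/val_inj.
by rewrite (row_mxEr z.1%:M z.2).
Qed.

Lemma rV_consK n : cancel (@rV_cons n) (@rV_uncons n).
Proof.
move=> [a v]; rewrite /rV_uncons rV_cons0; congr (_, _).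
by apply/rowP => j; rewrite mxE rV_cons_lift.
Qed.

Lemma measurable_rV_cons n : measurable_fun setT (@rV_cons n).
Proof.
apply: measurable_fun_rV => i; case: (unliftP ord0 i) => [j|] ->.
  under eq_fun do rewrite rV_cons_lift.
  by apply: (measurableT_comp (@measurable_coord n j)).
under eq_fun do rewrite rV_cons0.
exact: measurable_fst.
Qed.

Lemma measurable_rV_uncons n : measurable_fun setT (@rV_uncons n).
Proof.
apply: measurable_fun_pair; first exact: measurable_coord.
apply: measurable_fun_rV => i /=.
under eq_fun do rewrite mxE.
exact: measurable_coord.
Qed.

End measurable_rV_theory.

Section lebesgue_measure_rV.
Context {R : realType}.
Local Open Scope ereal_scope.

Section step.
Context (n : nat) (mu : {sigma_finite_measure set 'rV[R]_n -> \bar R}).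

Definition lebesgue_rV_step : set 'rV[R]_n.+1 -> \bar R :=
  pushforward ((@lebesgue_measure R) \x mu) (@rV_cons R n).

Let lebesgue_rV_step_measure : {measure set 'rV[R]_n.+1 -> \bar R} :=
  measure_function_pushforward__canonical__measure_function_Measure
    ((@lebesgue_measure R) \x mu) (@measurable_rV_cons R n).

HB.instance Definition _ :=
  Measure.copy lebesgue_rV_step lebesgue_rV_step_measure.

Let lebesgue_rV_step_sigma_finite : sigma_finite setT lebesgue_rV_step.
Proof.
have [[F TF Foo]] := lebesgue_integral_fubini.measure_function_Measure_isSigmaFinite__to__measure_function_isSigmaFinite
  (@lebesgue_measure R) mu.
exists (fun k => @rV_uncons R n @^-1` F k).
  by rewrite -preimage_bigcup -TF preimage_setT.
move=> k; have [mFk Fkoo] := Foo k; split.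
  by rewrite -[X in measurable X]setTI; exact: measurable_rV_uncons.
rewrite /lebesgue_rV_step /pushforward -comp_preimage.
rewrite (_ : _ \o _ = id)//.
by apply/funext => z /=; rewrite rV_consK.
Qed.

HB.instance Definition _ := Measure_isSigmaFinite.Build _ _ _
  lebesgue_rV_step lebesgue_rV_step_sigma_finite.

End step.

(* Lebesgue measure on R^n as the n-fold product of one-dimensional Lebesgue
   measures, see lebesgue_rV_box; the library has binary products only. *)
Fixpoint lebesgue_rV (n : nat) :
    {sigma_finite_measure set 'rV[R]_n -> \bar R} :=
  match n with
  | 0 => \d_(0%R : 'rV[R]_0)
  | m.+1 => lebesgue_rV_step (lebesgue_rV m)
  end.

Lemma lebesgue_rV_box n (A : 'I_n -> set R) : (forall i, measurable (A i)) ->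
  lebesgue_rV n [set x | forall i, A i (x ord0 i)] =
  \prod_(i < n) lebesgue_measure (A i).
Proof.
elim: n A => [|n ih] A mA.
  rewrite big_ord0 /= diracE mem_set//= => -[].
  by [].
pose B := [set x : 'rV[R]_n | forall i, A (lift ord0 i) (x ord0 i)].
have mB : measurable B.
  rewrite (_ : B = \bigcap_(i in [set: 'I_n])
      ((fun x : 'rV[R]_n => x ord0 i) @^-1` A (lift ord0 i))).
    apply: fin_bigcap_measurable => // i _.
    by rewrite -[X in measurable X]setTI; exact: measurable_coord.
  by apply/seteqP; split=> [x Ax i _|x Ax i]; [exact: Ax|exact: (Ax i I)].
rewrite big_ord_recl -(ih (fun i => A (lift ord0 i)))//= -/B.
rewrite -product_measure1E// /lebesgue_rV_step /pushforward.
congr (product_measure1 _ _ _).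
apply/seteqP; split=> [[a v] /= Aav|[a v] /= [Aa Bv] i].
  split=> [|i]; first by have := Aav ord0; rewrite rV_cons0.
  by have := Aav (lift ord0 i); rewrite rV_cons_lift.
by case: (unliftP ord0 i) => [j|] ->; rewrite ?rV_cons_lift ?rV_cons0.
exact: mA.
Qed.

End lebesgue_measure_rV.

(* 'rV[R]_n is normed by the library with the sup norm `|x|, which induces the
   usual topology; the Euclidean norm is enorm. *)
Section euclidean.
Context {R : realType} {n : nat}.
Implicit Types x y : 'rV[R]_n.

Definition dotp x y : R := \sum_(i < n) x ord0 i * y ord0 i.

Definition enorm x : R := Num.sqrt (dotp x x).

Definition orthogonal_transformation (O : {linear 'rV[R]_n -> 'rV[R]_n}) :=
  forall x y, dotp (O x) (O y) = dotp x y.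

End euclidean.

Definition e_last {R : realType} {n : nat} : 'rV[R]_n.+1 :=
  delta_mx ord0 ord_max.

Section weak_derivatives.
Context {R : realType} {n : nat}.
Implicit Types (f g u phi : 'rV[R]_n -> R) (G : 'rV[R]_n -> 'rV[R]_n).

Local Notation mu := (lebesgue_rV n).

Definition partial (i : 'I_n) f (x : 'rV[R]_n) : R :=
  'D_(delta_mx ord0 i) f x.

Fixpoint class_C (k : nat) f : Prop :=
  match k with
  | 0 => continuous f
  | k'.+1 => [/\ continuous f,
      forall i x, derivable f x (delta_mx ord0 i) &
      forall i, class_C k' (partial i f)]
  end.

Definition test_function phi :=
  (forall k, class_C k phi) /\ compact (closure [set x | phi x != 0]).

Definition locally_integrable_rV f :=
  measurable_fun [set: 'rV[R]_n] f /\
  forall K : set 'rV[R]_n, compact K -> (\int[mu]_(x in K) `|f x|%:E < +oo)%E.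

Definition weak_partial (i : 'I_n) u g :=
  [/\ locally_integrable_rV u, locally_integrable_rV g &
    forall phi, test_function phi ->
      (\int[mu]_x (u x * partial i phi x)%:E =
       - \int[mu]_x (g x * phi x)%:E)%E].

(* The weak gradient is determined up to a.e. equality only, hence a relation
   between u and the possible versions G of Du. *)
Definition weak_gradient u G :=
  forall i, weak_partial i u (fun x => G x ord0 i).

(* For p > n every class in D^{1,p} has a unique continuous representative;
   the elements of D1p are these representatives. *)
Definition D1p (p : R) u :=
  continuous u /\
  exists2 G, weak_gradient u G &
    forall i, (fun x => G x ord0 i) \in Lfun mu p%:E.

End weak_derivatives.

Section morrey.
Context {R : realType} {n : nat}.
Implicit Types (p C : R) (u v : 'rV[R]_n -> R) (x y : 'rV[R]_n).

Local Notation mu := (lebesgue_rV n).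

Definition holder_quotient p u x y : R :=
  `|u x - u y| / enorm (x - y) `^ (1 - n%:R / p).

Definition holder_seminorm p u : \bar R :=
  ereal_sup [set (holder_quotient p u xy.1 xy.2)%:E
            | xy in [set xy : 'rV[R]_n * 'rV[R]_n | xy.1 != xy.2]].

Definition morrey_inequality p C :=
  forall v G, D1p p v -> weak_gradient v G ->
    (holder_seminorm p v <= C%:E * 'N[mu]_p%:E[EFin \o enorm \o G])%E.

Definition sharp_morrey_constant p C :=
  morrey_inequality p C /\ forall C', morrey_inequality p C' -> C <= C'.

Definition morrey_extremal p u :=
  [/\ D1p p u, ~ (exists c, forall x, u x = c) &
    exists Cstar G, [/\ sharp_morrey_constant p Cstar, weak_gradient u G &
      holder_seminorm p u =
      (Cstar%:E * 'N[mu]_p%:E[EFin \o enorm \o G])%E]].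

End morrey.

(* Main.v *)
(* Let O be an orthogonal map fixing e_n, or the reflection T, with sign s = 1,
   respectively s = -1. The function v = s (u o O) has the values of u at the two
   poles and the same p-energy as u, since Lebesgue measure is invariant under O.
   Hence w = (u + v) / 2 also takes these values, so its Hoelder seminorm is at
   least that of u, and Morrey's inequality for w shows that the p-energy of w is
   at least that of u. As p > n >= 2, Clarkson's inequality
     |(a + b)/2|^p + |(a - b)/2|^p <= (|a|^p + |b|^p)/2
   then forces Du = Dv almost everywhere. So u - v is constant, and it vanishes
   at e_n. *)
Require Import Defs.
From HB Require Import structures.
From mathcomp Require Import all_boot all_order all_algebra.
From mathcomp Require Import all_classical all_reals all_analysis.
From mathcomp Require Import measurable_realfun.
From mathcomp Require Import ring lra.

Set Implicit Arguments.
Unset Strict Implicit.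
Unset Printing Implicit Defensive.

Import Order.TTheory GRing.Theory Num.Theory.
Import numFieldNormedType.Exports.

Local Open Scope classical_set_scope.
Local Open Scope ring_scope.

(** * Invariance of Lebesgue measure *)

(** Two facts that the overview merely names carry most of the work. The first is invariance of
    [lebesgue_rV] under [O]. The measure is built one coordinate at a time and a general orthogonal
    map does not respect that splitting, so induction on the dimension reaches translations only;
    orthogonal maps are then reduced to translations by a double integral. The second is the passage
    from [Du = Dv] almost everywhere to [u - v] constant. Only weak derivatives are at hand, so
    constancy must come from test functions. Rather than mollifying, one explicit bump is moved
    around: a vanishing weak gradient makes its pairing with [u - v] independent of the centre, and
    continuity does the rest. Clarkson's inequality is needed for Euclidean vectors; for [p >= 2] it
    follows from the parallelogram law, because [t ^ (p/2)] is both superadditive and convex.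
    Finally, the seminorm of [u] is a positive real, being attained at the poles. This makes the
    sharp constant positive and the energy finite, which licenses every cancellation in the extended
    reals. *)

Section measure_preserving.
Context d (T : measurableType d) (R : realType).
Variables (mu : {measure set T -> \bar R}) (phi : T -> T).
Hypothesis mphi : measurable_fun setT phi.
Hypothesis muphi : forall A, measurable A -> mu (phi @^-1` A) = mu A.
Local Open Scope ereal_scope.

Lemma ge0_integral_preserving (f : T -> \bar R) :
  measurable_fun setT f -> (forall x, 0 <= f x) ->
  \int[mu]_x f (phi x) = \int[mu]_x f x.
Proof.
move=> mf f0.
rewrite -(ge0_integral_pushforward mphi mu measurableT mf)//.
by apply: eq_measure_integral => /= A mA _; exact: muphi.
Qed.

Lemma integrable_preserving (f : T -> \bar R) :
  mu.-integrable setT f -> mu.-integrable setT (f \o phi).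
Proof.
move=> /integrableP[mf foo]; apply/integrableP; split.
  exact: measurableT_comp.
rewrite (ge0_integral_preserving (f := abse \o f))//.
  exact: measurableT_comp.
by move=> x; exact: abse_ge0.
Qed.

Lemma integral_preserving (f : T -> \bar R) :
  mu.-integrable setT f -> \int[mu]_x f (phi x) = \int[mu]_x f x.
Proof.
move=> intf; have /integrableP[mf _] := intf.
transitivity (\int[pushforward mu phi]_x f x).
  by rewrite (integral_pushforward mphi mf)//; exact: integrable_preserving.
by apply: eq_measure_integral => /= A mA _; exact: muphi.
Qed.

End measure_preserving.

Section lebesgue_rV_invariance.
Context {R : realType}.

(** Lebesgue measure is determined by its values on the intervals []b, c]], and shifting such an
    interval keeps its length. *)
Lemma lebesgue_measure_translation (a : R) (A : set R) : measurable A ->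
  lebesgue_measure ((fun x : R => x + a) @^-1` A) = lebesgue_measure A :> \bar R.
Proof.
move=> mA.
have mf : measurable_fun setT
    (fun x : measurableTypeR R => (x + a : measurableTypeR R)).
  exact: measurable_funD.
apply/esym; apply: (lebesgue_measure_unique
 (mu := measure_function_pushforward__canonical__measure_function_Measure
    (@lebesgue_measure R) mf)) => //= _ [[b c]] _ <-.
rewrite /pushforward.
have -> : (fun x : R => x + a) @^-1` `]b, c] = `]b - a, c - a]%classic.
  apply/seteqP; split => x /=; rewrite !in_itv/= ltrBlDr lerBrDr//.
rewrite !lebesgue_measure_itv/= !lte_fin ltrD2r.
by case: ifP => // _; rewrite -!EFinD; congr EFin; rewrite opprB addrA subrK.
Qed.

Lemma measurable_rV_translation n (a : 'rV[R]_n) :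
  measurable_fun setT (fun x : 'rV[R]_n => x + a).
Proof.
apply: measurable_fun_rV => i.
under eq_fun do rewrite mxE.
by apply: measurable_funD => //; exact: measurable_coord.
Qed.

Lemma measurable_rV_mulmx n (M : 'M[R]_n) :
  measurable_fun setT (fun x : 'rV[R]_n => x *m M).
Proof.
apply: measurable_fun_rV => i.
under eq_fun do rewrite mxE.
apply: measurable_sum => j; apply: measurable_funM => //; exact: measurable_coord.
Qed.

(** Induction on the dimension: the fibre over [x] of the shifted set is the fibre of the set over
    [x + a0], shifted by [a']. The induction hypothesis absorbs [a'], and the one-dimensional case
    absorbs [a0]. *)
Lemma lebesgue_rV_translation n (a : 'rV[R]_n) (A : set 'rV[R]_n) :
  measurable A -> lebesgue_rV n ((fun x => x + a) @^-1` A) = lebesgue_rV n A.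
Proof.
elim: n a A => [|n ih] a A mA.
  by congr (lebesgue_rV 0 _); apply/funext => x /=; congr A; apply/rowP => -[].
rewrite /= /lebesgue_rV_step /pushforward /product_measure1.
pose a0 := a ord0 ord0; pose a' := \row_j a ord0 (lift ord0 j).
pose B := rV_cons (n := n) @^-1` A.
have mB : measurable B.
  by rewrite -[X in measurable X]setTI; exact: measurable_rV_cons.
have consD (x : R) (y : 'rV[R]_n) :
    rV_cons (x + a0, y + a') = rV_cons (x, y) + a.
  apply/rowP => i; case: (unliftP ord0 i) => [j|] ->.
    by rewrite [RHS]mxE !rV_cons_lift !mxE.
  by rewrite [RHS]mxE !rV_cons0.
transitivity (\int[lebesgue_measure]_x
   (lebesgue_rV n \o xsection B) ((x : R) + a0)%R)%E.
  apply: eq_integral => x _ /=.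
  rewrite -[RHS](ih a'); last exact: measurable_xsection.
  congr (lebesgue_rV n _); apply/seteqP; split => y /=.
    by rewrite /xsection/= !inE /B/= consD.
  by rewrite /xsection/= !inE /B/= consD.
have mt : measurable_fun setT
    (fun x : measurableTypeR R => (x + a0 : measurableTypeR R)).
  exact: measurable_funD.
apply: (ge0_integral_preserving mt (@lebesgue_measure_translation a0)) => //.
exact: measurable_fun_xsection.
Qed.

Lemma dotp_mulmx n (x y : 'rV[R]_n) : dotp x y = (x *m y^T) 0 0.
Proof. by rewrite !mxE /dotp; apply: eq_bigr => i _; rewrite mxE. Qed.

Lemma measurable_dotp n : measurable_fun setT (fun x : 'rV[R]_n => dotp x x).
Proof.
by apply: measurable_sum => i; apply: measurable_funM; exact: measurable_coord.
Qed.

Lemma coord_le_dotp n (x : 'rV[R]_n) i : x ord0 i ^+ 2 <= dotp x x.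
Proof.
rewrite /dotp (bigD1 i)//= -expr2 lerDl sumr_ge0// => j _.
by rewrite -expr2 sqr_ge0.
Qed.

Lemma measurable_rV_box n (A : 'I_n -> set R) : (forall i, measurable (A i)) ->
  measurable [set x : 'rV[R]_n | forall i, A i (x ord0 i)].
Proof.
move=> mA; rewrite (_ : [set _ | _] = \bigcap_(i in [set: 'I_n])
    ((fun x : 'rV[R]_n => x ord0 i) @^-1` A i)).
  apply: fin_bigcap_measurable => // i _.
  by rewrite -[X in measurable X]setTI; apply: measurable_coord => //; exact: mA.
by apply/seteqP; split=> [x Ax i _|x Ax i]; [exact: Ax|exact: (Ax i I)].
Qed.

Lemma measurable_rV_cube n (e : R) :
  measurable [set x : 'rV[R]_n | forall i, x ord0 i \in `]-e, e[].
Proof.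
by apply: (@measurable_rV_box n (fun=> `]-e, e[%classic)) => i; exact: measurable_itv.
Qed.

Lemma lebesgue_rV_cube n (e : R) : 0 < e ->
  lebesgue_rV n [set x : 'rV[R]_n | forall i, x ord0 i \in `]-e, e[] =
  ((e *+ 2) ^+ n)%:E.
Proof.
move=> e0; rewrite (lebesgue_rV_box (A := fun=> `]-e, e[%classic))//.
under eq_bigr do rewrite lebesgue_measure_itv/= lte_fin gtrN// opprK.
rewrite -mulr2n; elim: n => [|n ih]; first by rewrite big_ord0.
by rewrite big_ord_recl ih exprS EFinM.
Qed.

Lemma measurable_unit_ball n : measurable [set x : 'rV[R]_n | dotp x x < 1].
Proof.
rewrite -[X in measurable X]setTI.
rewrite (_ : [set _ | _] = (fun x : 'rV[R]_n => dotp x x) @^-1` `]-oo, 1[).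
  exact: measurable_dotp.
by apply/seteqP; split => x /=; rewrite in_itv.
Qed.

(** With [e = r / n.+1], both [n e < r] and [e <= r] hold, so [n e^2 < r^2]. Dividing by [n.+1]
    avoids square roots and keeps the bound strict, also for [n = 0]. *)
Lemma cube_dotp n (r : R) (x : 'rV[R]_n) : 0 < r ->
  (forall i, x ord0 i \in `]- (r / n.+1%:R), r / n.+1%:R[) ->
  dotp x x < r ^+ 2.
Proof.
move=> r0 xr; set e := r / n.+1%:R in xr.
have e0 : 0 < e by rewrite divr_gt0.
have ner : n%:R * e < r.
  by rewrite /e mulrCA gtr_pMr// ltr_pdivrMr// mul1r ltr_nat.
have er : e <= r by rewrite /e ler_pdivrMr// ler_peMr ?ler1n// ltW.
apply: (@le_lt_trans _ _ (\sum_(i < n) e ^+ 2)).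
  apply: ler_sum => i _; rewrite -expr2 -real_normK ?num_real//.
  have : `|x ord0 i| <= e by move: (xr i); rewrite in_itv/= -ltr_norml => /ltW.
  by move=> h; apply: (le_trans (lerXn2r 2 _ _ h)); rewrite ?nnegrE// ltW.
rewrite sumr_const card_ord -[ltLHS]mulr_natl expr2 mulrA.
apply: (@le_lt_trans _ _ (n%:R * e * r)).
  by rewrite ler_wpM2l// mulr_ge0// ltW.
by rewrite expr2 ltr_pM2r.
Qed.

(** The ball lies between two cubes of known volume. Positivity and finiteness are what allow its
    measure to be cancelled in the proof of orthogonal invariance. *)
Lemma lebesgue_rV_unit_ball n :
  (0 < lebesgue_rV n [set x : 'rV[R]_n | (dotp x x < 1)%R] < +oo)%E.
Proof.
have mb := mem_set (@measurable_unit_ball n).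
have mcube e := mem_set (@measurable_rV_cube n e).
apply/andP; split.
  have e0 : 0 < (1 / n.+1%:R : R) by rewrite divr_gt0.
  apply: (@lt_le_trans _ _ (((1 / n.+1%:R : R) *+ 2) ^+ n)%:E).
    by rewrite lte_fin exprn_gt0// mulrn_wgt0.
  rewrite -lebesgue_rV_cube//; apply: le_measure; [exact: mcube|exact: mb|].
  by move=> x /= xe; have := cube_dotp ltr01 xe; rewrite expr1n.
apply: (@le_lt_trans _ _ (((1:R) *+ 2) ^+ n)%:E); last by rewrite ltry.
rewrite -lebesgue_rV_cube//.
apply: le_measure; [exact: mb|exact: mcube|move=> x /= x1 i].
rewrite in_itv/= -ltr_norml -(@ltr_pXn2r _ 2)// ?nnegrE//.
by rewrite expr1n real_normK ?num_real// (le_lt_trans _ x1)// coord_le_dotp.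
Qed.

(* With [B] the unit ball, which is symmetric and invariant under [M], evaluate
   the double integral of [1_A(x M) 1_B(y - x M)] in both orders: translation
   invariance alone gives [mu(M^-1 A) mu(B) = mu(A) mu(B)]. *)
Lemma lebesgue_rV_orthogonal n (M : 'M[R]_n) (A : set 'rV[R]_n) :
  M *m M^T = 1%:M -> measurable A ->
  lebesgue_rV n ((fun x => x *m M) @^-1` A) = lebesgue_rV n A.
Proof.
move=> MM mA; have MM' : M^T *m M = 1%:M by exact: mulmx1C.
pose mu : {sigma_finite_measure set 'rV[R]_n -> \bar R} := lebesgue_rV n.
pose B := [set x : 'rV[R]_n | dotp x x < 1].
have mB : measurable B := @measurable_unit_ball n.
have BN x : B (- x) = B x.
  by rewrite /B/= !dotp_mulmx linearN/= mulmxN mulNmx opprK.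
have BM x : B (x *m M) = B x.
  by rewrite /B/= !dotp_mulmx trmx_mul mulmxA -(mulmxA x) MM mulmx1.
have m1 (C : set 'rV[R]_n) : measurable C ->
    measurable_fun setT (fun x => (\1_C x : R)%:E).
  by move=> mC; apply/measurable_EFinP; exact: measurable_indic.
have mM := @measurable_rV_mulmx n M.
have shift a (f : 'rV[R]_n -> \bar R) : measurable_fun setT f ->
    (forall x, 0 <= f x)%E -> (\int[mu]_x f (x + a)%R = \int[mu]_x f x)%E.
  exact: (ge0_integral_preserving (measurable_rV_translation a)
    (lebesgue_rV_translation a)).
have ind0 (C : set 'rV[R]_n) x : (0 <= (\1_C x : R)%:E)%E by rewrite lee_fin.
have intB : (\int[mu]_x (\1_B x)%:E = mu B)%E by rewrite integral_indic// setIT.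
have intA : (\int[mu]_x (\1_A x)%:E = mu A)%E by rewrite integral_indic// setIT.
have intAM : (\int[mu]_x (\1_A (x *m M))%:E = mu ((mulmx^~ M) @^-1` A))%E.
  have mC : measurable ((mulmx^~ M) @^-1` A).
    by rewrite -[X in measurable X]setTI; exact: mM.
  by rewrite -[in RHS](setIT (_ @^-1` _)) -integral_indic.
have /andP[_ Boo] := lebesgue_rV_unit_ball n.
have Bfin : mu B \is a fin_num by rewrite ge0_fin_numE.
suff : (mu ((mulmx^~ M) @^-1` A) * mu B = mu A * mu B)%E.
  have Bi : (fine (mu B))%:E = mu B by rewrite fineK.
  have B1 : ((fine (mu B))^-1%:E * mu B = 1)%E.
    rewrite -Bi -EFinM mulVf// gt_eqF// fine_gt0// Bi; exact: lebesgue_rV_unit_ball.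
  move=> /(congr1 (fun z => z * (fine (mu B))^-1%:E)%E).
  by rewrite -!muleA ![(mu B * _)%E]muleC B1 !mule1.
pose F (x y : 'rV[R]_n) : \bar R := (\1_A (x *m M) * \1_B (y - x *m M))%:E.
have mF : measurable_fun setT (fun z : 'rV[R]_n * 'rV[R]_n => F z.1 z.2).
  apply/measurable_EFinP/measurable_funM.
    apply: measurableT_comp; first exact: measurable_indic.
    by apply: (measurableT_comp mM); exact: measurable_fst.
  apply: measurableT_comp; first exact: measurable_indic.
  apply: measurable_fun_rV => i; under eq_fun do rewrite !mxE.
  apply: measurable_funB.
    by apply: (measurableT_comp (measurable_coord i)); exact: measurable_snd.
  apply: measurable_sum => j; apply: measurable_funM => //.
  by apply: (measurableT_comp (measurable_coord j)); exact: measurable_fst.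
have F0 x y : (0 <= F x y)%E by rewrite lee_fin mulr_ge0.
transitivity (\int[mu]_x \int[mu]_y F x y)%E.
  rewrite -intAM -ge0_integralZr//; last first.
    exact: (measurableT_comp (m1 _ mA) mM).
  apply: eq_integral => x _; rewrite -intB -(shift (- (x *m M)))//; last exact: m1.
  rewrite -ge0_integralZl//.
  apply: (measurableT_comp (m1 _ mB)); exact: measurable_rV_translation.
rewrite (fubini_tonelli (fun z => F z.1 z.2))//=.
(* For fixed [y], translate [x] by [y *m M^T], whose image under [M] is [y]: then [x *m M] becomes
   [x *m M + y], and [y - x *m M] becomes [- x *m M], which lies in [B] exactly when [x] does. *)
transitivity (\int[mu]_y \int[mu]_x (\1_A (x *m M + y) * \1_B x)%:E)%E.
  apply: eq_integral => y _; rewrite -[LHS](shift (y *m M^T))//; last first.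
    have h := measurableT_comp mF (measurable_pair2 y). exact: h.
  apply: eq_integral => x _; rewrite /F mulmxDl -mulmxA MM' mulmx1.
  rewrite opprD addrCA subrr addr0; congr (_ * _)%:E.
  by rewrite !indicE; congr (_%:R); congr (nat_of_bool _); apply/idP/idP;
     rewrite !inE BN BM.
rewrite (fubini_tonelli (fun z => (\1_A (z.2 *m M + z.1) * \1_B z.2)%:E))//=;
  last first.
  apply/measurable_EFinP/measurable_funM; last first.
    by apply: measurableT_comp; first exact: measurable_indic.
  apply: measurableT_comp; first exact: measurable_indic.
  apply: measurable_fun_rV => i; under eq_fun do rewrite !mxE.
  apply: measurable_funD.
    apply: measurable_sum => j; apply: measurable_funM => //.
    by apply: (measurableT_comp (measurable_coord j)); exact: measurable_snd.
  by apply: (measurableT_comp (measurable_coord i)); exact: measurable_fst.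
rewrite -intB -ge0_integralZl//; last exact: m1.
apply: eq_integral => x _.
under eq_integral do rewrite EFinM (addrC (x *m M)).
rewrite ge0_integralZr//.
  by rewrite -intA -[in RHS](shift (x *m M))//; exact: m1.
apply: (measurableT_comp (m1 _ mA)); exact: measurable_rV_translation.
Qed.

End lebesgue_rV_invariance.

(** * Smooth functions and test functions *)

Section directional_derivatives.
Context {R : realType}.

Lemma is_deriveP {V : normedModType R} (f : V -> R) (x v : V) (d : R) :
  is_derive x v f d <->
  (fun h => h^-1 *: ((f \o shift x) (h *: v) - f x)) @ 0^' --> d.
Proof.
split=> [[df <-]//|fd]; apply: DeriveDef; last exact: cvg_lim fd.
by apply/cvg_ex; exists d.
Qed.

(** Directional derivatives become derivatives of functions of one real variable, where the chain
    rule and the mean value theorem are available. *)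
Lemma is_derive_lineP {V : normedModType R} (f : V -> R) (x v : V) (s d : R) :
  is_derive (s *: v + x) v f d <->
  is_derive s 1 (fun h : R => f (h *: v + x)) d.
Proof.
apply: (iff_trans (is_deriveP _ _ _ _)); apply: iff_sym.
apply: (iff_trans (is_deriveP _ _ _ _)).
rewrite (_ : (fun h : R => h^-1 *: _) = (fun h : R => h^-1 *:
   ((f \o shift (s *: v + x)) (h *: v) - f (s *: v + x))))//.
by apply/funext => h /=; rewrite /shift/= [h%:A]mulr1 scalerDl addrA.
Qed.

Lemma is_derive_dirZ {V : normedModType R} (f : V -> R) (x v : V) (c d : R) :
  is_derive x v f d -> is_derive x (c *: v) f (c * d).
Proof.
move=> fd; rewrite -[x]add0r -(scale0r (c *: v)).
apply: (@is_derive_lineP _ f x (c *: v) 0 (c * d)).2.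
have fl : is_derive (c * 0) 1 (fun h : R => f (h *: v + x)) d.
  by rewrite mulr0; apply: (@is_derive_lineP _ f x v 0 d).1; rewrite scale0r add0r.
have cl : is_derive (0 : R) 1 (fun h : R => c * h) c.
  by rewrite -[c in is_derive _ _ _ c]mulr1; exact: is_deriveZ.
rewrite mulrC; have := is_derive1_comp fl cl; congr is_derive.
by apply/funext => h /=; rewrite scalerA mulrC.
Qed.

Lemma MVT_line {V : normedModType R} (f : V -> R) (y v : V) (t : R) :
  (forall x, derivable f x v) ->
  exists2 c : R, `|c| <= `|t| & f (t *: v + y) - f y = t * 'D_v f (c *: v + y).
Proof.
move=> fv; pose g (h : R) := f (h *: v + y).
have dg (s : R) : is_derive s 1 g ('D_v f (s *: v + y)).
  by apply: (@is_derive_lineP _ f y v s _).1; apply: DeriveDef.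
have cg (A : set R) : {within A, continuous g}.
  apply: continuous_subspaceT => s.
  apply: differentiable_continuous; apply/derivable1_diffP.
  by have [] := dg s.
have g0 : f y = g 0 by rewrite /g scale0r add0r.
rewrite g0 -/(g t); have [t0|t0] := leP 0 t.
  have [c] := MVT_segment t0 (fun x _ => dg x) (cg _).
  rewrite in_itv/= => /andP[c0 ct]; rewrite subr0 mulrC => ->.
  by exists c => //; rewrite !ger0_norm.
have [c] := MVT_segment (ltW t0) (fun x _ => dg x) (cg _).
rewrite in_itv/= => /andP[tc c0]; rewrite sub0r mulrN mulrC => gE.
exists c; first by rewrite !ler0_norm ?lerN2// ltW.
by rewrite -opprB gE opprK.
Qed.

(** Go from [x] to [x + h a], then to [x + h a + h b]. The first leg gives [da]; by the mean value
    theorem the second contributes ['D_b f] at a point tending to [x], hence ['D_b f x] by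
    continuity there. *)
Lemma is_derive_dirD {V : normedModType R} (f : V -> R) (x a b : V) (da : R) :
  is_derive x a f da -> (forall y, derivable f y b) ->
  {for x, continuous (fun y => 'D_b f y)} ->
  is_derive x (a + b) f (da + 'D_b f x).
Proof.
move=> fa fb cDb; apply/is_deriveP.
have /is_deriveP fa' := fa.
rewrite (_ : (fun h : R => h^-1 *: _) = (fun h : R =>
    h^-1 *: ((f \o shift x) (h *: a) - f x) +
    h^-1 * (f (h *: b + (h *: a + x)) - f (h *: a + x)))); last first.
  apply/funext => h /=; rewrite /shift/= (scalerDr h a b) addrA (addrC (h *: b)).
  by rewrite -[RHS]mulrDr [X in _ = _ * X]addrC subrKA.
apply: cvgD => //; apply/cvgrPdist_lt => e e0.
move/cvgrPdist_lt : cDb => /(_ _ e0) /nbhs_ballP[r /= r0 rD].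
(* The intermediate point is within [|h| (|a| + |b|)] of [x]; the extra 1 makes the divisor positive
   when [a = b = 0]. *)
have ab0 : 0 < `|a| + `|b| + 1 by rewrite ltr_wpDl// addr_ge0.
have : \forall h \near 0^', `|h : R| < r / (`|a| + `|b| + 1).
  by apply: dnbhs0_lt; rewrite divr_gt0.
apply: filterS2 (nbhs_dnbhs_neq _) => h h0 hr.
have [c ch ->] := @MVT_line _ f (h *: a + x) b h fb.
rewrite mulKf//; apply: rD; rewrite -ball_normE/= distrC addrA addrK.
rewrite (le_lt_trans (ler_normD _ _))// !normrZ.
apply: (@le_lt_trans _ _ (`|h| * (`|a| + `|b| + 1))).
  rewrite addrC !mulrDr mulr1 -addrA lerD2l ler_wpDr// ler_wpM2r//.
by rewrite -ltr_pdivlMr.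
Qed.

End directional_derivatives.

Section smooth_functions.
Context {R : realType} {n : nat}.
Implicit Types (f g : 'rV[R]_n -> R).

(** [class_C] only provides partial derivatives, so a general direction is assembled one coordinate
    at a time by [is_derive_dirD]. This is the form of differentiability behind the chain rule
    [is_derive_mulmx]. *)
Lemma is_derive_C1 f x v : (forall i y, derivable f y (delta_mx ord0 i)) ->
  (forall i, continuous (partial i f)) ->
  is_derive x v f (\sum_(i < n) v ord0 i * partial i f x).
Proof.
move=> df cf; rewrite [v in is_derive _ v](row_sum_delta v).
elim: (index_enum _) x => [|i s ih] x; first by rewrite !big_nil; exact: is_derive0.
rewrite !big_cons [X in is_derive _ X]addrC [X in is_derive _ _ _ X]addrC.
have di y : is_derive y (v ord0 i *: delta_mx ord0 i) f (v ord0 i * partial i f y).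
  by apply: is_derive_dirZ; exact: DeriveDef.
have Di : (fun y => 'D_(v ord0 i *: delta_mx ord0 i) f y) =
    (fun y => v ord0 i * partial i f y).
  by apply/funext => y; rewrite derive_val.
have := is_derive_dirD (ih x) (b := v ord0 i *: delta_mx ord0 i).
rewrite Di derive_val; apply.
  by move=> y; have [] := di y.
by apply: continuousM; [exact: cst_continuous|exact: cf].
Qed.

Lemma class_C_continuous k f : class_C k f -> continuous f.
Proof. by case: k => //= k []. Qed.

Lemma class_CS k f : class_C k.+1 f -> class_C k f.
Proof.
elim: k f => [f []//|k ih f [cf df pf]].
by split => // i; exact: ih.
Qed.

Lemma class_C_cst k (c : R) : class_C k (fun _ : 'rV[R]_n => c).
Proof.
elim: k c => [|k ih] c /=; first by move=> x; exact: cst_continuous.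
split; [by move=> x; exact: cst_continuous|by move=> i x; exact: derivable_cst|].
move=> i; rewrite (_ : partial i _ = fun=> 0)//.
by apply/funext => x; rewrite /partial derive_cst.
Qed.

Lemma class_CD k f g : class_C k f -> class_C k g -> class_C k (f \+ g).
Proof.
elim: k f g => [f g cf cg x|k ih f g [cf df pf] [cg dg pg]].
  by apply: continuousD; [exact: cf|exact: cg].
split; first by move=> x; apply: continuousD; [exact: cf|exact: cg].
  by move=> i x; apply: derivableD; [exact: df|exact: dg].
move=> i; rewrite (_ : partial i _ = partial i f \+ partial i g).
  exact: (ih _ _ (pf i) (pg i)).
by apply/funext => x; rewrite /partial deriveD.
Qed.

Lemma class_CM k f g : class_C k f -> class_C k g -> class_C k (f \* g).
Proof.
elim: k f g => [f g cf cg x|k ih f g Cf Cg].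
  by apply: continuousM; [exact: cf|exact: cg].
have [cf df pf] := Cf; have [cg dg pg] := Cg.
split; first by move=> x; apply: continuousM; [exact: cf|exact: cg].
  by move=> i x; apply: derivableM; [exact: df|exact: dg].
move=> i; rewrite (_ : partial i _ = f \* partial i g \+ g \* partial i f).
  apply: class_CD; first exact: (ih _ _ (class_CS Cf) (pg i)).
  exact: (ih _ _ (class_CS Cg) (pf i)).
by apply/funext => x; rewrite /partial deriveM.
Qed.

Lemma class_C_sum k (I : Type) (s : seq I) (F : I -> 'rV[R]_n -> R) :
  (forall i, class_C k (F i)) -> class_C k (fun x => \sum_(i <- s) F i x).
Proof.
move=> CF; elim: s => [|i s ih].
  by under eq_fun do rewrite big_nil; exact: class_C_cst.
by under eq_fun do rewrite big_cons; exact: class_CD.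
Qed.

Lemma class_C_coord k (j : 'I_n) : class_C k (fun x : 'rV[R]_n => x ord0 j).
Proof.
have dc (i : 'I_n) (x : 'rV[R]_n) : is_derive x (delta_mx ord0 i)
    (fun x : 'rV[R]_n => x ord0 j) (i == j)%:R.
  apply/is_deriveP; apply: (cvg_near_cst).
  have := nbhs_dnbhs_neq (0 : R); apply: filterS => h h0.
  by rewrite /shift/= !mxE eqxx/= addrK [_ *: _]mulrA mulVf// mul1r eq_sym.
case: k => [|k]; first exact: coord_continuous.
split; first exact: coord_continuous.
  by move=> i x; have [] := dc i x.
move=> i; rewrite (_ : partial i _ = fun=> (i == j)%:R); first exact: class_C_cst.
by apply/funext => x; rewrite /partial derive_val.
Qed.

Lemma continuous_mulmx (M : 'M[R]_n) : continuous (fun x : 'rV[R]_n => x *m M).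
Proof.
have cM (j : 'I_n) : continuous (fun y : 'rV[R]_n => (y *m M) ord0 j).
  under eq_fun do rewrite mxE.
  apply: (@class_C_sum 0 _ _ (fun i y => y ord0 i * M i j)) => i.
  exact: (class_CM (class_C_coord 0 i) (class_C_cst 0 _)).
move=> x A /= [P MP sPA].
have : \forall y \near x, forall j, P ord0 j ((y *m M) ord0 j).
  apply: (@filter_forall _ _
    (fun j => (fun y => P ord0 j ((y *m M) ord0 j))) (nbhs x)) => j.
  exact: (cM j x _ (MP ord0 j)).
by apply: filterS => y Py; apply: sPA => i j; rewrite ord1; exact: Py.
Qed.

Lemma is_derive_mulmx f (M : 'M[R]_n) x i :
  (forall i y, derivable f y (delta_mx ord0 i)) ->
  (forall i, continuous (partial i f)) ->
  is_derive x (delta_mx ord0 i) (fun y => f (y *m M))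
    (\sum_(j < n) M i j * partial j f (x *m M)).
Proof.
move=> df cf.
have /is_deriveP := is_derive_C1 (x *m M) (row i M) df cf.
under [in X in _ --> X]eq_bigr do rewrite mxE.
move=> fM; apply/is_deriveP.
rewrite (_ : (fun h : R => h^-1 *: _) = (fun h : R => h^-1 *:
  ((f \o shift (x *m M)) (h *: row i M) - f (x *m M))))//.
by apply/funext => h /=; rewrite /shift/= mulmxDl -scalemxAl -rowE.
Qed.

Lemma continuous_comp_mulmx (T : topologicalType) (f : 'rV[R]_n -> T)
  (M : 'M[R]_n) : continuous f -> continuous (fun x : 'rV[R]_n => f (x *m M)).
Proof.
move=> cf x.
exact: (continuous_comp (@continuous_mulmx M x) (cf (x *m M))).
Qed.

Lemma class_C_mulmx k f (M : 'M[R]_n) :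
  class_C k f -> class_C k (fun x => f (x *m M)).
Proof.
elim: k f => [|k ih] f.
  exact: continuous_comp_mulmx.
move=> [cf df pf].
have dM := is_derive_mulmx M _ _ df (fun i => class_C_continuous (pf i)).
split.
- exact: continuous_comp_mulmx.
- by move=> i x; have [] := dM x i.
move=> i; rewrite (_ : partial i _ =
    fun x => \sum_(j < n) M i j * partial j f (x *m M)).
  apply: class_C_sum => j; apply: class_CM; first exact: class_C_cst.
  exact: (ih _ (pf j)).
by apply/funext => x; rewrite /partial derive_val.
Qed.

Lemma test_functionP (phi : 'rV[R]_n -> R) : test_function phi <->
  (forall k, class_C k phi) /\
  exists2 K, compact K & forall x, phi x != 0 -> K x.
Proof.
split=> [[Cphi Kphi]|[Cphi [K cK sK]]]; split=> //.
  by exists (closure [set x | phi x != 0]) => // x ?; exact: subset_closure.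
apply: (subclosed_compact _ cK); first exact: closed_closure.
have := compact_closed (@norm_hausdorff _ _) cK.
by rewrite closure_id => ->; exact: closure_subset.
Qed.

Lemma test_function_mulmx (phi : 'rV[R]_n -> R) (M : 'M[R]_n) :
  M \in unitmx -> test_function phi -> test_function (fun x => phi (x *m M)).
Proof.
move=> uM /test_functionP[Cphi [K cK sK]]; apply/test_functionP; split.
  by move=> k; exact: class_C_mulmx.
exists ((mulmx^~ (invmx M)) @` K).
  apply: continuous_compact => //; apply: continuous_subspaceT.
  exact: continuous_mulmx.
by move=> x /sK Kx; exists (x *m M) => //; rewrite mulmxK.
Qed.

(** The complement of [K] is open and [phi] vanishes on it, so difference quotients there are
    eventually 0 and [K] supports the derivative as well. *)
Lemma partial_test_function (phi : 'rV[R]_n -> R) i :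
  test_function phi -> test_function (partial i phi).
Proof.
move=> /test_functionP[Cphi [K cK sK]]; apply/test_functionP; split.
  by move=> k; have [_ _ pC] := Cphi k.+1; exact: pC.
exists K => // x; apply: contraNP => /= Kx.
have clK := compact_closed (@norm_hausdorff _ _) cK.
rewrite /partial; apply/eqP/cvg_lim => //; apply: cvg_near_cst.
have : \forall y \near x, phi y = 0.
  have := closed_openC clK; rewrite openE => /(_ x Kx); apply: filterS => y Ky.
  by apply/eqP; apply: contraT => /sK.
move=> phi0.
have phix0 := nbhs_singleton phi0.
have : (h *: delta_mx ord0 i + x : 'rV[R]_n) @[h --> (0 : R)] --> x.
  rewrite -[in X in _ --> X](add0r x) -(scale0r (delta_mx ord0 i)).
  by apply: cvgD; [apply: cvgZr_tmp|exact: cvg_cst].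
move=> /(_ _ phi0) /= /nbhs_dnbhs; apply: filterS => h /= hphi.
by rewrite /shift/= hphi phix0 subr0 scaler0.
Qed.

Lemma test_function_bounded (phi : 'rV[R]_n -> R) :
  test_function phi -> exists2 M : R, 0 <= M & forall x, `|phi x| <= M.
Proof.
move=> /test_functionP[Cphi [K cK sK]].
have /compact_bounded[M [_ Mb]] : compact (phi @` K).
  apply: continuous_compact => //; apply: continuous_subspaceT.
  exact: (class_C_continuous (Cphi 0)).
exists (`|M| + 1); first by rewrite addr_ge0.
move=> x; have [->|/sK Kx] := eqVneq (phi x) 0; first by rewrite normr0 addr_ge0.
apply: Mb; last by exists x.
by rewrite (le_lt_trans (ler_norm M))// ltrDl.
Qed.

End smooth_functions.

(** * Locally integrable functions and weak derivatives *)

Section borel_rV.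
Context {R : realType} {n : nat}.

(** This links the topology with the sigma-algebra generated by the coordinates: an open set is a
    countable union of boxes with rational centres and half-sides [1 / m.+1]. *)
Lemma open_measurable_rV (U : set 'rV[R]_n) : open U -> measurable U.
Proof.
move=> oU.
pose box (z : 'rV[rat]_n * nat) := [set x : 'rV[R]_n | forall i, x ord0 i \in
  `]ratr (z.1 ord0 i) - z.2.+1%:R^-1, ratr (z.1 ord0 i) + z.2.+1%:R^-1[].
(* Boxes not inside [U] are replaced by the empty set, so that the union runs over a whole countable
   type. *)
pose F z := if pselect (box z `<=` U) then box z else set0.
have -> : U = \bigcup_z F z.
  apply/seteqP; split => [x Ux|x [z _]]; last first.
    by rewrite /F; case: pselect => // zU /zU.
  have : nbhs x U by apply: open_nbhs_nbhs; split.
  move=> /nbhs_ballP[e /= e0 eU].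
  (* The centre is within [1 / m.+1] of [x] and so is every point of the box from the centre, in
     each coordinate; two such steps must stay below [e]. *)
  have [m me] : exists m : nat, m.+1%:R^-1 < e / 2.
    by have /(_ (e / 2)) := @ltr_add_invr R 0; rewrite divr_gt0// => /(_ isT)[m];
      rewrite add0r; exists m.
  have m0 : 0 < m.+1%:R^-1 :> R by rewrite invr_gt0.
  have qP i : exists q : rat,
      ratr q \in `]x ord0 i - m.+1%:R^-1, x ord0 i + m.+1%:R^-1[.
    apply: rat_in_itvoo; rewrite ltrBlDr -addrA ltrDl addr_gt0//.
  pose q : 'rV[rat]_n := \row_i projT1 (cid (qP i)).
  have qx i : ratr (q ord0 i) \in `]x ord0 i - m.+1%:R^-1, x ord0 i + m.+1%:R^-1[.
    by rewrite mxE; case: cid.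
  exists (q, m) => //; rewrite /F; case: pselect => [?|]; last first.
    case; move=> y /= qy; apply: eU; split => // i j.
    have -> : i = ord0 by apply/val_inj; rewrite ord1.
    rewrite /ball/=.
    move: (qx j) (qy j); rewrite !in_itv/= => /andP[x1 x2] /andP[y1 y2].
    rewrite ltr_norml; move: me x1 x2 y1 y2.
    move: (x ord0 j : R) (y ord0 j : R) (ratr _ : R) (m.+1%:R^-1 : R) => a b c d.
    move=> *; apply/andP; split; lra.
  move=> i /=; move: (qx i); rewrite !in_itv/=.
  move: (x ord0 i : R) (ratr _ : R) (m.+1%:R^-1 : R) => a b c /andP[x1 x2].
  by apply/andP; split; lra.
apply: countable_bigcupT_measurable => // z.
rewrite /F; case: pselect => ? /=; last exact: measurable0.
apply: (@measurable_rV_box _ _ (fun i => `]ratr (z.1 ord0 i) - z.2.+1%:R^-1,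
  ratr (z.1 ord0 i) + z.2.+1%:R^-1[%classic)) => i.
exact: measurable_itv.
Qed.

Lemma compact_measurable_rV (K : set 'rV[R]_n) : compact K -> measurable K.
Proof.
move=> /(compact_closed (@norm_hausdorff _ _)) cK; rewrite -[K]setCK.
by apply: measurableC; apply: open_measurable_rV; exact: closed_openC.
Qed.

Lemma continuous_measurable_rV (f : 'rV[R]_n -> R) :
  continuous f -> measurable_fun setT f.
Proof.
move=> /continuousP cf; apply: (measurability _ (RGenOInfty.measurableE R)).
move=> /= _ [_ [a ->] <-]; rewrite setTI; apply: open_measurable_rV.
exact/cf/interval_open.
Qed.

Lemma compact_lebesgue_rV_ltey (K : set 'rV[R]_n) : compact K ->
  (lebesgue_rV n K < +oo)%E.
Proof.
move=> cK; have mK := compact_measurable_rV cK.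
have [M [_ Mb]] := compact_bounded cK.
(* [compact_bounded] yields a bound for each number above [M], here [|M| + 1]; one more unit puts
   [K] inside the open cube. *)
have e0 : 0 < `|M| + 2 by rewrite ltr_wpDl.
apply: (@le_lt_trans _ _ (((`|M| + 2) *+ 2) ^+ n)%:E); last exact: ltry.
rewrite -lebesgue_rV_cube//; apply: le_measure.
- exact: mem_set.
- exact: (mem_set (@measurable_rV_cube R n _)).
move=> x Kx /= i; rewrite in_itv/= -ltr_norml.
apply: (@le_lt_trans _ _ `|x|).
  rewrite [leRHS]/Num.norm /= mx_normrE.
  by apply/bigmax_geP; right; exists (ord0, i).
apply: (@le_lt_trans _ _ (`|M| + 1)); last by rewrite ltrD2l (ltr_nat _ 1 2).
apply: Mb Kx; rewrite (le_lt_trans (ler_norm M))// ltrDl//.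
Qed.

End borel_rV.

Section locally_integrable.
Context {R : realType} {n : nat}.
Implicit Types (f g : 'rV[R]_n -> R).
Local Notation mu := (lebesgue_rV n).

Lemma locally_integrableP f : locally_integrable_rV f <->
  measurable_fun setT f /\
  forall K, compact K -> mu.-integrable K (EFin \o f).
Proof.
split=> -[mf fK]; split => // K cK; last by have /integrableP[] := fK _ cK.
apply/integrableP; split; last exact: fK.
by apply/measurable_EFinP; exact: measurable_funTS.
Qed.

Lemma locally_integrableD f g : locally_integrable_rV f ->
  locally_integrable_rV g -> locally_integrable_rV (f \+ g).
Proof.
move=> /locally_integrableP[mf fK] /locally_integrableP[mg gK].
apply/locally_integrableP; split; first exact: measurable_funD.
move=> K cK; have mK := compact_measurable_rV cK.
by have := integrableD mK (fK _ cK) (gK _ cK).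
Qed.

Lemma locally_integrableZ (a : R) f : locally_integrable_rV f ->
  locally_integrable_rV (fun x => a * f x).
Proof.
move=> /locally_integrableP[mf fK].
apply/locally_integrableP; split; first exact: measurable_funM.
move=> K cK; have mK := compact_measurable_rV cK.
by have := integrableZl mK a (fK _ cK).
Qed.

Lemma integrable_patch f (K : set 'rV[R]_n) : locally_integrable_rV f ->
  compact K -> mu.-integrable setT ((EFin \o f) \_ K).
Proof.
move=> /locally_integrableP[mf fK] cK.
by apply/(integrable_mkcond _ (compact_measurable_rV cK)); exact: fK.
Qed.

Lemma integrable_test f phi : locally_integrable_rV f -> test_function phi ->
  mu.-integrable setT (fun x => (f x * phi x)%:E).
Proof.
move=> lf tphi; have [M M0 phiM] := test_function_bounded tphi.
have /test_functionP[Cphi [K cK sK]] := tphi.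
have mf := lf.1.
apply: (le_integrable _ _ _ (integrableZl _ M (integrable_patch lf cK))) => //.
  apply/measurable_EFinP/measurable_funM => //.
  exact: (continuous_measurable_rV (class_C_continuous (Cphi 0))).
move=> x _; rewrite patchE; case: ifPn => [/set_mem|/negP] Kx.
  by rewrite /= lee_fin !normrM mulrC ler_wpM2r// (ger0_norm M0).
have -> : phi x = 0 by apply/eqP; apply: contraT => /sK /mem_set.
by rewrite mulr0 mule0.
Qed.

(** On [K] the function agrees with the composite of [M] and [f] cut off outside the compact image
    of [K]; that composite is integrable on the whole space by invariance. *)
Lemma locally_integrable_mulmx f (M : 'M[R]_n) : M *m M^T = 1%:M ->
  locally_integrable_rV f -> locally_integrable_rV (fun x => f (x *m M)).
Proof.
move=> MM lf; have mf := lf.1.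
have mM := @measurable_rV_mulmx R n M.
split; first exact: (measurableT_comp mf).
move=> K cK.
pose K' := (mulmx^~ M) @` K.
have cK' : compact K'.
  apply: continuous_compact => //; apply: continuous_subspaceT.
  exact: continuous_mulmx.
have /integrableP[mi ioo] := integrable_preserving mM
  (fun A => @lebesgue_rV_orthogonal _ n M A MM) (integrable_patch lf cK').
apply: le_lt_trans ioo; rewrite [leLHS]integral_mkcond.
apply: ge0_le_integral => //.
- by move=> y _; apply: erestrict_ge0 => // x _; rewrite lee_fin.
- apply: (iffLR (measurable_restrictT _ (compact_measurable_rV cK))).
  apply/measurable_EFinP; apply: measurable_funTS; apply: measurableT_comp => //.
  exact: (measurableT_comp mf).
- exact: measurableT_comp.
move=> x _; rewrite patchE; case: ifPn => [/set_mem Kx|_]; last exact: abse_ge0.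
by rewrite /= patchE ifT//; apply/mem_set; exists x.
Qed.

End locally_integrable.

Section weak_partial.
Context {R : realType} {n : nat}.
Implicit Types (u v g h : 'rV[R]_n -> R).
Local Notation mu := (lebesgue_rV n).

Lemma weak_partial_lincomb i (a b : R) u v g h :
  weak_partial i u g -> weak_partial i v h ->
  weak_partial i (fun x => a * u x + b * v x) (fun x => a * g x + b * h x).
Proof.
have key (f1 f2 phi : 'rV[R]_n -> R) : locally_integrable_rV f1 ->
    locally_integrable_rV f2 -> test_function phi ->
    (\int[mu]_x ((a * f1 x + b * f2 x) * phi x)%:E =
     a%:E * \int[mu]_x (f1 x * phi x)%:E + b%:E * \int[mu]_x (f2 x * phi x)%:E)%E.
  move=> l1 l2 tphi.
  have i1 := integrable_test l1 tphi; have i2 := integrable_test l2 tphi.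
  rewrite -!integralZl// -integralD//; last 2 first.
  - exact: integrableZl.
  - exact: integrableZl.
  by apply: eq_integral => x _; rewrite -!EFinM -EFinD mulrDl !mulrA.
move=> [lu lg ug] [lv lh vh]; split.
- by apply: locally_integrableD; exact: locally_integrableZ.
- by apply: locally_integrableD; exact: locally_integrableZ.
move=> phi tphi; have tdphi := partial_test_function i tphi.
rewrite !key// ug// vh// !muleN oppeD// fin_num_adde_defl//.
by rewrite fin_numM//; apply: integrable_fin_num => //; exact: integrable_test.
Qed.

(** Write [phi] as [psi (x *m M)] with [psi x = phi (x *m M^T)]. The chain rule expresses the
    partial derivatives of [phi] through those of [psi], and the substitution [x *m M] turns both
    sides into the defining identities of [G] tested against [psi]. *)
Lemma weak_gradient_mulmx u G (M : 'M[R]_n) : M *m M^T = 1%:M ->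
  weak_gradient u G ->
  weak_gradient (fun x => u (x *m M)) (fun x => G (x *m M) *m M^T).
Proof.
move=> MM uG i; have MM' : M^T *m M = 1%:M by exact: mulmx1C.
have uM : M^T \in unitmx by exact: (mulmx1_unit MM).2.
have lG j : locally_integrable_rV (fun x => G x ord0 j) by case: (uG j).
have lu : locally_integrable_rV u by case: (uG i).
have chg (f : 'rV[R]_n -> R) psi : locally_integrable_rV f -> test_function psi ->
    (\int[mu]_x (f (x *m M) * psi (x *m M))%:E = \int[mu]_x (f x * psi x)%:E)%E.
  move=> lf tpsi; have := integrable_test lf tpsi.
  exact: (integral_preserving (@measurable_rV_mulmx R n M)
    (fun A => @lebesgue_rV_orthogonal _ n M A MM)).
have sumE (f : 'I_n -> 'rV[R]_n -> R) (psi : 'I_n -> 'rV[R]_n -> R) :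
   (forall j, locally_integrable_rV (f j)) -> (forall j, test_function (psi j)) ->
   (\int[mu]_x (\sum_j M i j * (f j x * psi j x))%:E =
    \sum_j (M i j)%:E * \int[mu]_x (f j x * psi j x)%:E)%E.
  move=> lf tpsi; under eq_integral do rewrite -sumEFin.
  rewrite integral_sum//=; last first.
    move=> j; under eq_fun do rewrite EFinM.
    by apply: integrableZl => //; exact: integrable_test.
  apply: eq_bigr => j _; under eq_integral do rewrite EFinM.
  by rewrite integralZl//; exact: integrable_test.
split.
- exact: locally_integrable_mulmx.
- have -> : (fun x => (G (x *m M) *m M^T) ord0 i) =
      (fun x => (fun y => \sum_j M i j * G y ord0 j) (x *m M)).
    by apply/funext => x; rewrite mxE; apply: eq_bigr => j _; rewrite mxE mulrC.
  apply: (@locally_integrable_mulmx _ _ (fun y => \sum_j M i j * G y ord0 j) M MM).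
  elim: (index_enum _) => [|j s ih].
    under eq_fun do rewrite big_nil.
    rewrite (_ : (fun=> 0) = (fun x => 0 * u x)); first exact: locally_integrableZ.
    by apply/funext => x; rewrite mul0r.
  under eq_fun do rewrite big_cons.
  by apply: locally_integrableD => //; exact: locally_integrableZ.
move=> phi tphi.
pose psi x := phi (x *m M^T).
have tpsi : test_function psi by exact: test_function_mulmx.
have phiE x : phi x = psi (x *m M) by rewrite /psi -mulmxA MM mulmx1.
have dphi x : partial i phi x = \sum_j M i j * partial j psi (x *m M).
  have -> : phi = (fun x => psi (x *m M)) by exact/funext.
  have [/(_ 1%N)[_ dpsi cpsi] _] := tpsi.
  by have := is_derive_mulmx M x i dpsi cpsi; rewrite /partial => -[].
have tdpsi j : test_function (partial j psi) by exact: partial_test_function.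
transitivity (\int[mu]_x (\sum_j M i j * (u x * partial j psi x))%:E)%E.
  rewrite -[RHS](integral_preserving (@measurable_rV_mulmx R n M)
    (fun A => @lebesgue_rV_orthogonal _ n M A MM)).
    apply: eq_integral => x _; rewrite dphi mulr_sumr; congr EFin.
    by apply: eq_bigr => j _; rewrite mulrCA.
  under eq_fun do rewrite -sumEFin.
  apply: integrable_sum => //= j _.
  under eq_fun do rewrite EFinM; apply: integrableZl => //; exact: integrable_test.
rewrite (sumE (fun=> u))//.
transitivity (- \int[mu]_x (\sum_j M i j * (G x ord0 j * psi x))%:E)%E; last first.
  congr (- _)%E.
  rewrite -[LHS](integral_preserving (@measurable_rV_mulmx R n M)
    (fun A => @lebesgue_rV_orthogonal _ n M A MM)).
    apply: eq_integral => x _; rewrite mxE mulr_suml; congr EFin.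
    by apply: eq_bigr => j _; rewrite mxE -phiE mulrA (mulrC (M i j)).
  under eq_fun do rewrite -sumEFin.
  apply: integrable_sum => //= j _.
  under eq_fun do rewrite EFinM; apply: integrableZl => //; exact: integrable_test.
rewrite (sumE (fun j x => G x ord0 j) (fun=> psi))//.
rewrite -sumeN//; last first.
  move=> j k _ _; apply: fin_num_adde_defl; rewrite fin_numM//.
  by apply: integrable_fin_num => //; exact: integrable_test.
apply: eq_bigr => j _; rewrite -muleN; congr (_ * _)%E.
by case: (uG j) => _ _; exact.
Qed.

End weak_partial.

(** * Bump functions *)

Section flat_functions.
Context {R : realType}.

(* The span of the [flat k] is closed under differentiation, so the partial
   derivatives of [flat 0 \o g] can be handled by induction, see class_C_flat. *)
Definition flat (k : nat) (t : R) : R :=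
  if 0 < t then t^-1 ^+ k * expR (- t^-1) else 0.

Lemma flat_gt0 k t : 0 < t -> 0 < flat k t.
Proof. by move=> t0; rewrite /flat t0 mulr_gt0 ?exprn_gt0 ?invr_gt0 ?expR_gt0. Qed.

Lemma flat_ge0 k t : 0 <= flat k t.
Proof.
by have [/flat_gt0/ltW//|t0] := ltP 0 t; rewrite /flat ltNge t0.
Qed.

Lemma flat_le0 k t : t <= 0 -> flat k t = 0.
Proof. by move=> t0; rewrite /flat ltNge t0. Qed.

(** From [s^(k+2) / (k+2)! <= exp s] at [s = 1/t]. A quadratic bound is what differentiability at 0
    requires. *)
Lemma flat_sqr k t : flat k t <= (k.+2)`!%:R * t ^+ 2.
Proof.
have [t0|t0] := ltP 0 t; last by rewrite flat_le0// mulr_ge0 ?sqr_ge0.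
rewrite /flat t0 expRN ler_pdivrMr ?expR_gt0//.
have ti0 : 0 <= t^-1 by rewrite invr_ge0 ltW.
have := expR_ge1Dxn k.+1 ti0.
rewrite -lerBrDl => h; have {h} : t^-1 ^+ k.+2 / (k.+2)`!%:R <= expR t^-1.
  by rewrite (le_trans h)// gerBl.
rewrite ler_pdivrMr ?ltr0n ?fact_gt0// => h.
have -> : t^-1 ^+ k = t ^+ 2 * t^-1 ^+ k.+2.
  rewrite -[k.+2]addn2 exprD mulrCA -exprMn divff ?gt_eqF// expr1n mulr1//.
by rewrite (mulrC _ (t ^+ 2)) -[leRHS]mulrA ler_wpM2l ?sqr_ge0// mulrC.
Qed.

(** Calculus away from 0; at 0, [flat_sqr] bounds the difference quotient by [(k+2)! |h|], so the
    derivative is 0. *)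
Lemma is_derive_flat k (t : R) :
  is_derive t 1 (flat k) (flat k.+2 t - k%:R * flat k.+1 t).
Proof.
have [t0|t0|<-] := ltgtP 0 t.
- apply: (@near_eq_is_derive R R^o R^o
    (fun s : R => s^-1 ^+ k * expR (- s^-1)) (flat k) t 1).
    have := lt_nbhsr t0; apply: filterS => s s0.
    by rewrite /flat s0.
  have dinv : is_derive t 1 (fun s : R => s^-1) (- t ^- 2).
    apply: DeriveDef; first by apply: derivableV; rewrite ?gt_eqF.
    by rewrite deriveV ?gt_eqF// derive_id [_ *: _]mulr1.
  have dX : is_derive t 1 (fun s : R => s^-1 ^+ k)
      ((k%:R * t^-1 ^+ k.-1) * - t ^- 2).
    have := is_deriveX k dinv; rewrite (_ : _ ^+ k = (fun s : R => s^-1 ^+ k))//.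
    by apply/funext => s; rewrite exprfctE.
  have dE : is_derive t 1 (fun s : R => expR (- s^-1)) (expR (- t^-1) * t ^- 2).
    have dN : is_derive t 1 (fun s : R => - s^-1) (t ^- 2).
      by have := is_deriveN dinv; rewrite opprK.
    exact: (@is_derive1_comp R expR (fun s : R => - s^-1) t _ _
      (is_derive_expR (- t^-1)) dN).
  have [dr drE] := is_deriveM dX dE.
  apply: DeriveDef; first exact: dr.
  apply: etrans drE _; rewrite /flat t0.
  rewrite /GRing.scale/=.
  case: k {dX dr} => [|k] /=; rewrite !exprS ?expr0.
    by field; rewrite gt_eqF.
  by rewrite -natr1; field; rewrite gt_eqF.
- apply: (@near_eq_is_derive R R^o R^o (cst 0) (flat k) t 1).
    have := lt_nbhsl t0; apply: filterS => s s0.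
    by rewrite flat_le0// ltW.
  by rewrite !flat_le0 ?ltW// mulr0 subr0; exact: is_derive_cst.
- rewrite !flat_le0// mulr0 subr0; apply/is_deriveP.
  set C : R := (k.+2)`!%:R; have C0 : 0 <= C by rewrite ler0n.
  apply/cvgrPdist_lt => e e0.
  have : \forall h \near (0 : R)^', `|h| < e / (C + 1).
    by apply: dnbhs0_lt; rewrite divr_gt0// ltr_wpDl.
  apply: filterS2 (nbhs_dnbhs_neq _) => h h0 he.
  rewrite /shift/= addr0 (@flat_le0 k 0)// subr0 sub0r normrN [h%:A]mulr1.
  rewrite normrM normfV ltr_pdivrMl ?normr_gt0// (ger0_norm (flat_ge0 _ _)).
  apply: (le_lt_trans (flat_sqr k h)).
  rewrite -/C -real_normK ?num_real// expr2 mulrCA ltr_pM2l ?normr_gt0//.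
  apply: (@le_lt_trans _ _ ((C + 1) * `|h|)).
    by rewrite ler_wpM2r// lerDl.
  by rewrite -ltr_pdivlMl// 1?mulrC// ltr_wpDl.
Qed.

Lemma continuous_flat k : continuous (flat k).
Proof.
move=> t; apply/differentiable_continuous/derivable1_diffP.
by have [] := is_derive_flat k t.
Qed.

End flat_functions.

Section bump.
Context {R : realType} {n : nat}.

Lemma is_derive_flat_comp k (g : 'rV[R]_n -> R) x v (dg : R) :
  is_derive x v g dg -> is_derive x v (flat k \o g)
    ((flat k.+2 (g x) - k%:R * flat k.+1 (g x)) * dg).
Proof.
move=> dgx.
have x0 : x = 0 *: v + x by rewrite scale0r add0r.
rewrite [x in is_derive x]x0; apply: (@is_derive_lineP _ _ (flat k \o g) x v 0 _).2.
have h1 : is_derive (0 : R) 1 (fun h : R => g (h *: v + x)) dg.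
  by apply: (@is_derive_lineP _ _ g x v 0 _).1; rewrite -x0.
have := is_derive1_comp (is_derive_flat k _) h1.
by rewrite -x0.
Qed.

Lemma class_C_flat m k (g : 'rV[R]_n -> R) :
  (forall m, class_C m g) -> class_C m (flat k \o g).
Proof.
move=> Cg; elim: m k => [|m ih] k.
  move=> x; apply: continuous_comp; first exact: (class_C_continuous (Cg 0)).
  exact: continuous_flat.
have [cg dg pg] := Cg m.+1.
have dfg i x := is_derive_flat_comp k (derivableP (dg i x)).
split.
- move=> x; apply: continuous_comp; first exact: (class_C_continuous (Cg 0)).
  exact: continuous_flat.
- by move=> i x; have [] := dfg i x.
move=> i; rewrite (_ : partial i _ = (flat k.+2 \o g \+
    (fun=> - k%:R) \* (flat k.+1 \o g)) \* partial i g).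
  apply: class_CM (pg i); apply: class_CD; first exact: ih.
  by apply: class_CM; [exact: class_C_cst|exact: ih].
by apply/funext => x; rewrite /partial derive_val /= mulNr.
Qed.

(** The standard bump [exp (-1 / (r^2 - |x - a|^2))] on the Euclidean ball, extended by 0. The
    squared Euclidean distance is a polynomial, hence smooth, unlike the sup norm. *)
Definition smooth_bump (a : 'rV[R]_n) (r : R) : 'rV[R]_n -> R :=
  flat 0 \o (fun x => r ^+ 2 - dotp (x - a) (x - a)).

Lemma bump_shift a b r x : smooth_bump (a + b) r (x + b) = smooth_bump a r x.
Proof.
have xab : x + b - (a + b) = x - a by rewrite opprD addrACA subrr addr0.
by rewrite /smooth_bump/= xab.
Qed.

Lemma class_C_paraboloid k (a : 'rV[R]_n) (r : R) :
  class_C k (fun x => r ^+ 2 - dotp (x - a) (x - a)).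
Proof.
have -> : (fun x : 'rV[R]_n => r ^+ 2 - dotp (x - a) (x - a)) =
    (fun=> r ^+ 2) \+ (fun=> -1) \* (fun x : 'rV[R]_n =>
      \sum_(i < n) (x ord0 i + - a ord0 i) * (x ord0 i + - a ord0 i)).
  apply/funext => x /=; rewrite mulN1r; congr (_ - _).
  by apply: eq_bigr => i _; rewrite !mxE.
apply: class_CD; first exact: class_C_cst.
apply: class_CM; first exact: class_C_cst.
apply: class_C_sum => i.
have CB := class_CD (class_C_coord k i) (class_C_cst k (- a ord0 i)).
exact: (class_CM CB CB).
Qed.

Lemma norm_le_dotp (x : 'rV[R]_n) r : 0 <= r -> dotp x x <= r ^+ 2 -> `|x| <= r.
Proof.
move=> r0 xr; rewrite [leLHS]/Num.norm /= mx_normrE.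
apply/bigmax_leP; split => // -[i j] _ /=; rewrite (ord1 i).
have := le_trans (coord_le_dotp x j) xr.
by rewrite -real_normK ?num_real// ler_pXn2r// ?nnegrE.
Qed.

(** The sup norm is at most the Euclidean norm, so the sup-norm ball, compact and convenient for the
    library topology, contains the support. *)
Lemma bump_support a r x : 0 <= r -> r < `|x - a| -> smooth_bump a r x = 0.
Proof.
move=> r0 rx; rewrite /smooth_bump/= flat_le0// subr_le0 leNgt; apply/negP => h.
by move: rx; rewrite ltNge norm_le_dotp// ltW.
Qed.

Lemma compact_closed_ball (a : 'rV[R]_n) r : compact [set x | `|x - a| <= r].
Proof.
apply: bounded_closed_compact.
  exists (r + `|a|); split; first exact: num_real.
  move=> M Mr x /= xr; rewrite (le_trans _ (ltW Mr))// -[x](subrK a).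
  by rewrite (le_trans (ler_normD _ _))// lerD2r.
rewrite (_ : [set _ | _] = (fun x => `|x - a|) @^-1` [set t | t <= r])//.
apply: closed_comp; last exact: closed_le.
move=> x _; apply: continuous_comp; last exact: norm_continuous.
apply: (@continuousB _ _ _ id (cst a)); first exact: cvg_id.
exact: cst_continuous.
Qed.

Lemma test_function_bump a r : 0 <= r -> test_function (smooth_bump a r).
Proof.
move=> r0; apply/test_functionP; split.
  by move=> k; apply: class_C_flat => m; exact: class_C_paraboloid.
exists [set x | `|x - a| <= r]; first exact: compact_closed_ball.
move=> x; apply: contraNP => /= /negP; rewrite -ltNge => /bump_support -> //.
Qed.

End bump.

(** * Functions with vanishing weak gradient *)

Section bump_derivative.
Context {R : realType} {n : nat}.
Local Notation mu := (lebesgue_rV n).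

Lemma partial_bump_shift i (a b x : 'rV[R]_n) r :
  partial i (smooth_bump (a + b) r) (x + b) = partial i (smooth_bump a r) x.
Proof.
rewrite /partial /derive.
rewrite (_ : (fun h : R => h^-1 *: ((smooth_bump (a + b) r \o _) _ - _)) =
  (fun h : R => h^-1 *: ((smooth_bump a r \o shift x) (h *: delta_mx ord0 i) -
                         smooth_bump a r x)))//.
by apply/funext => h; rewrite /shift/= addrA !bump_shift.
Qed.

Lemma partial_bump_support i a (r : R) (x : 'rV[R]_n) : 0 <= r ->
  r < `|x - a| -> partial i (smooth_bump a r) x = 0.
Proof.
move=> r0 rx; have [_ dg _] := class_C_paraboloid 1 a r.
have := is_derive_flat_comp 0 (derivableP (dg i x)).
rewrite !flat_le0; first by move=> [_]; rewrite mulr0 subr0 mul0r.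
  rewrite subr_le0 leNgt; apply/negP => h.
  by move: rx; rewrite ltNge norm_le_dotp// ltW.
rewrite subr_le0 leNgt; apply/negP => h.
by move: rx; rewrite ltNge norm_le_dotp// ltW.
Qed.

(** Moving the centre one way is moving the argument the other way, which explains the sign. *)
Lemma is_derive_bump_center i (a y : 'rV[R]_n) r (h : R) : 0 <= r ->
  is_derive h 1 (fun h' : R => smooth_bump (a + h' *: delta_mx ord0 i) r y)
    (- partial i (smooth_bump (a + h *: delta_mx ord0 i) r) y).
Proof.
move=> r0; set e := delta_mx ord0 i; set b := a + h *: e.
have [/(_ 1%N)[_ db _] _] := test_function_bump b r0.
(* The point 0 is written [h - h] because the chain rule needs the value at [h] of the inner map
   [h - s]. *)
have fs : is_derive (h - h) 1 (fun s : R => smooth_bump b r (s *: e + y))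
    (partial i (smooth_bump b r) y).
  apply: (@is_derive_lineP _ _ (smooth_bump b r) y e (h - h) _).1.
  by rewrite subrr scale0r add0r; apply: DeriveDef; [exact: db|].
have gs : is_derive h 1 (fun s : R => h - s) (-1).
  have := is_deriveB (is_derive_cst h h 1) (is_derive_id h 1).
  by rewrite sub0r.
have := @is_derive1_comp R (fun s : R => smooth_bump b r (s *: e + y))
  (fun s : R => h - s) h _ _ fs gs.
rewrite mulrN1.
rewrite (_ : _ \o _ = (fun h' : R => smooth_bump (a + h' *: e) r y))//.
apply/funext => s /=.
have -> : b = (a + s *: e) + (h - s) *: e.
  by rewrite -addrA -scalerDl (addrC s) subrK.
by rewrite (addrC _ y) bump_shift.
Qed.

Lemma continuous_locally_integrable (f : 'rV[R]_n -> R) :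
  continuous f -> locally_integrable_rV f.
Proof.
move=> cf; have mf := continuous_measurable_rV cf.
split=> // K cK; have mK := compact_measurable_rV cK.
have [M [_ Mb]] : bounded_set (f @` K).
  apply: compact_bounded; apply: continuous_compact => //.
  exact: continuous_subspaceT.
apply: (@le_lt_trans _ _ (\int[mu]_(x in K) (cst (`|M| + 1)%:E) x)%E).
  apply: ge0_le_integral => //.
  - by apply/measurable_EFinP; apply: measurable_funTS; exact: measurableT_comp.
  move=> x Kx; rewrite lee_fin; apply: Mb; last by exists x.
  by rewrite (le_lt_trans (ler_norm M))// ltrDl.
rewrite integral_cst// lte_mul_pinfty// ?lee_fin ?addr_ge0//.
exact: compact_lebesgue_rV_ltey.
Qed.

End bump_derivative.

Section constancy.
Context {R : realType} {n : nat}.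
Local Notation mu := (lebesgue_rV n).
Variable f : 'rV[R]_n -> R.
Hypothesis cf : continuous f.
Hypothesis f0 : forall i phi, test_function phi ->
  (\int[mu]_x (f x * partial i phi x)%:E = 0)%E.

Let lf : locally_integrable_rV f.
Proof. exact: continuous_locally_integrable. Qed.

(* The integral is differentiable in [s], with derivative
   [- \int f * partial i (smooth_bump _ r)], which vanishes by [f0]. *)
Lemma integral_bump_line i a r (s : R) : 0 <= r ->
  \int[mu]_x (f x * smooth_bump (a + s *: delta_mx ord0 i) r x) =
  \int[mu]_x (f x * smooth_bump a r x).
Proof.
move=> r0; set e := delta_mx ord0 i.
pose F s := \int[mu]_x (f x * smooth_bump (a + s *: e) r x).
suff F0 (h0 : R) : is_derive h0 1 F 0.
  have := is_derive_0_is_cst s 0 F0; rewrite /F scale0r addr0; exact.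
pose g (s : R) x := f x * smooth_bump (a + s *: e) r x.
have dg (h : R) y : is_derive h 1 (g ^~ y)
    (- (f y * partial i (smooth_bump (a + h *: e) r) y)).
  have := is_deriveZ (f y) (is_derive_bump_center i a y h r0).
  by rewrite scalerN.
(* Domination for differentiating under the integral: by translation, one bound [M] for the bump at
   the origin serves every centre, and [K] contains the supports for all parameters within 1 of
   [h0]. *)
have tpb : test_function (partial i (smooth_bump 0 r) : 'rV[R]_n -> R).
  exact/partial_test_function/test_function_bump.
have [M M0 bM] := test_function_bounded tpb.
pose K := [set x : 'rV[R]_n | `|x - a| <= r + (`|h0| + 1) * `|e|].
have cK : compact K by exact: compact_closed_ball.
pose G y := if y \in K then M * `|f y| else 0.
have intg h : mu.-integrable setT (EFin \o g h).
  by apply: integrable_test => //; exact: test_function_bump.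
have intG : mu.-integrable setT (EFin \o G).
  rewrite /G.
  have := integrableZl measurableT M (integrable_abse (integrable_patch lf cK)).
  apply: eq_integrable => // x _ /=.
  rewrite patchE; case: ifPn => _; first by rewrite EFinM.
  by rewrite -[RHS](mule0 M%:E) -abse0.
have h0I : `]h0 - 1, h0 + 1[%classic h0.
  by rewrite /= in_itv/= ltrBlDr ltrDl ltr01.
have G0 y : 0 <= G y by rewrite /G; case: ifP => // _; rewrite mulr_ge0.
have dgG h y : `]h0 - 1, h0 + 1[%classic h -> setT y ->
    `|partial1of2 g h y| <= G y.
  rewrite /= in_itv/= => /andP[h1 h2] _.
  rewrite partial1of2E; have [_ ->] := dg h y.
  rewrite normrN normrM /G.
  case: ifPn => [_|/negP yK].
    rewrite mulrC ler_wpM2r//.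
    rewrite -[y](subrK (a + h *: e)) -[X in smooth_bump X _](add0r (a + h *: e)).
    by rewrite partial_bump_shift.
  have yr : r < `|y - (a + h *: e)|.
    rewrite ltNge; apply/negP => yr; apply: yK; apply/mem_set; rewrite /K/=.
    have -> : y - a = (y - (a + h *: e)) + h *: e by rewrite opprD addrA subrK.
    rewrite (le_trans (ler_normD _ _))// lerD// normrZ ler_wpM2r//.
    rewrite -lerBlDl (le_trans (lerB_dist _ _))// ler_norml.
    by apply/andP; split; lra.
  by rewrite partial_bump_support// normr0 mulr0.
have intgI h : `]h0 - 1, h0 + 1[%classic h -> mu.-integrable setT (EFin \o g h).
  by move=> _; exact: intg.
have dgI h y : `]h0 - 1, h0 + 1[%classic h -> setT y -> derivable (g ^~ y) h 1.
  by move=> _ _; have [] := dg h y.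
apply: DeriveDef.
  exact: (derivable_under_integral measurableT h0I intgI dgI G0 intG dgG).
rewrite -derive1E.
rewrite (differentiation_under_integral measurableT h0I intgI dgI G0 intG dgG).
rewrite /Rintegral; transitivity (fine
    (\int[mu]_x (- (f x * partial i (smooth_bump (a + h0 *: e) r) x)%:E)))%E.
  congr fine; apply: eq_integral => y _; rewrite partial1of2E.
  by have [_ ->] := dg h0 y.
have tp := test_function_bump (a + h0 *: e) r0.
have it := integrable_test lf (partial_test_function i tp).
rewrite (integralN (integrable_add_def measurableT it)).
by rewrite f0// oppe0.
Qed.

(** The centre is carried from 0 to [a] along the coordinate axes, one at a time. *)
Lemma integral_bump_center a r : 0 <= r ->
  \int[mu]_x (f x * smooth_bump a r x) = \int[mu]_x (f x * smooth_bump 0 r x).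
Proof.
move=> r0; rewrite [a in LHS](row_sum_delta a).
elim: (index_enum _) => [|i s ih]; first by rewrite big_nil.
by rewrite big_cons addrC integral_bump_line.
Qed.

(** Translating [f] by [a] amounts to moving the bump to the centre [a], which does not change the
    integral. *)
Lemma integral_bump_translate a r : 0 <= r ->
  (\int[mu]_x ((f (x + a) - f x) * smooth_bump 0 r x)%:E = 0)%E.
Proof.
move=> r0; have tb (b : 'rV[R]_n) := test_function_bump b r0.
have lfa : locally_integrable_rV (fun x => f (x + a)).
  apply: continuous_locally_integrable => x.
  apply: continuous_comp; last exact: cf.
  by apply: continuousD; [exact: cvg_id|exact: cst_continuous].
have i0 := integrable_test lf (tb 0).
have ia := integrable_test lfa (tb 0).
under eq_integral do rewrite mulrBl EFinB.
rewrite integralB//.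
have -> : (\int[mu]_x (f (x + a)%R * smooth_bump 0 r x)%:E =
    \int[mu]_x (f x * smooth_bump a r x)%:E)%E.
  have <- := integral_preserving (measurable_rV_translation a)
    (lebesgue_rV_translation a) (integrable_test lf (tb a)).
  apply: eq_integral => x _; congr (_ * _)%:E.
  by rewrite -(bump_shift 0 a) add0r.
(* [integral_bump_center] is about real-valued integrals; finiteness transfers it to the extended
   reals. *)
have i0a := integrable_fin_num measurableT (integrable_test lf (tb a)).
have i00 := integrable_fin_num measurableT i0.
have E := etrans (esym (fineK i0a))
  (etrans (congr1 EFin (integral_bump_center a r0)) (fineK i00)).
by rewrite [X in (X - _)%E]E subee.
Qed.

End constancy.

Section constancy_theorem.
Context {R : realType} {n : nat}.
Local Notation mu := (lebesgue_rV n).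

(** For small [r] the integrand is nonnegative everywhere and positive on a cube inside the ball. A
    zero integral would make this cube null. *)
Lemma integral_bump_neq0 (f : 'rV[R]_n -> R) : continuous f -> 0 < f 0 ->
  exists2 r, 0 < r & (\int[mu]_x (f x * smooth_bump 0 r x)%:E != 0)%E.
Proof.
move=> cf f0.
have /nbhs_ballP[d /= d0 df] : \forall x \near (0 : 'rV[R]_n), 0 < f x.
  exact: (cvgr_gt (f 0) (cf 0) _ f0).
have r0 : 0 < d / 2 by rewrite divr_gt0.
exists (d / 2) => //; set r := d / 2 in r0 *; apply/eqP => int0.
have fpos x : `|x| <= r -> 0 < f x.
  move=> xr; apply: df; rewrite -ball_normE/= sub0r normrN (le_lt_trans xr)//.
  by rewrite /r ltr_pdivrMr// ltr_pMr// (ltr_nat _ 1 2).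
have g0 x : 0 <= f x * smooth_bump 0 r x.
  have [xr|xr] := leP `|x| r; first by rewrite mulr_ge0 ?flat_ge0// ltW// fpos.
  by rewrite bump_support ?mulr0 ?subr0// ltW.
have lg := integrable_test (continuous_locally_integrable cf)
  (test_function_bump 0 (ltW r0)).
have /integrableP[mg _] := lg.
have : (\int[mu]_x `|(f x * smooth_bump 0 r x)%:E| = 0)%E.
  by under eq_integral do rewrite gee0_abs ?lee_fin//.
move=> /(ae_eq_integral_abs mu measurableT mg)[N [mN N0 sN]].
pose c := r / n.+1%:R.
have c0 : 0 < c by rewrite divr_gt0.
have := lebesgue_rV_cube n c0.
suff -> : lebesgue_rV n [set x : 'rV[R]_n | forall i, x ord0 i \in `]-c, c[] = 0%E.
  by move=> /esym/eqP; rewrite eqe gt_eqF// exprn_gt0// mulrn_wgt0.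
apply/eqP; rewrite eq_le measure_ge0 andbT -N0; apply: le_measure.
- exact: (mem_set (@measurable_rV_cube R n _)).
- exact: mem_set.
move=> x /= xc; apply: sN => /= /(_ I) /eqP; apply/negP.
have xr := cube_dotp r0 xc.
rewrite eqe gt_eqF// mulr_gt0//.
  by apply: fpos; apply: norm_le_dotp; rewrite ltW.
by rewrite /smooth_bump/= flat_gt0// subr_gt0 subr0.
Qed.

(** If [f b < f a], then [f (x + a) - f (x + b)] is positive at 0, yet [integral_bump_translate]
    makes its integral against every bump centred at 0 vanish. *)
Lemma weak_gradient0_cst (f : 'rV[R]_n -> R) : continuous f ->
  (forall i phi, test_function phi ->
    (\int[mu]_x (f x * partial i phi x)%:E = 0)%E) ->
  forall x y, f x = f y.
Proof.
move=> cf f0.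
have cfa (a : 'rV[R]_n) : continuous (fun x : 'rV[R]_n => f (x + a)).
  move=> x; apply: continuous_comp; last exact: cf.
  by apply: continuousD; [exact: cvg_id|exact: cst_continuous].
suff fle (a b : 'rV[R]_n) : f a <= f b by move=> x y; apply/le_anti; rewrite !fle.
rewrite leNgt; apply/negP => ab.
pose g x := f (x + a) - f (x + b).
have cg : continuous g by move=> x; apply: continuousB; exact: cfa.
have g0 : 0 < g 0 by rewrite /g !add0r subr_gt0.
have [r r0 /eqP] := integral_bump_neq0 cg g0; apply.
have cgc (c : 'rV[R]_n) : continuous (fun x : 'rV[R]_n => f (x + c) - f x).
  by move=> x; apply: continuousB; [exact: cfa|exact: cf].
have ic c := integrable_test (continuous_locally_integrable (cgc c))
  (test_function_bump 0 (ltW r0)).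
transitivity (\int[mu]_x (((f (x + a) - f x) * smooth_bump 0 r x)%:E -
    ((f (x + b) - f x) * smooth_bump 0 r x)%:E))%E.
  by apply: eq_integral => x _; rewrite -EFinB -mulrBl opprB addrA subrK.
rewrite integralB; [|by []|exact: ic|exact: ic].
by rewrite !(integral_bump_translate cf f0) ?ltW// sube0.
Qed.
End constancy_theorem.

(** * Clarkson's inequality and the energy *)

Section clarkson.
Context {R : realType}.

(** Write [z^q = z * z^(q-1) <= z * (x + y)^(q-1)] for [z = x] and [z = y], and add. *)
Lemma powR_superadditive (x y q : R) : 0 <= x -> 0 <= y -> 1 <= q ->
  x `^ q + y `^ q <= (x + y) `^ q.
Proof.
move=> x0 y0 q1; have q0 : 0 < q by rewrite (lt_le_trans _ q1).
have xy0 := addr_ge0 x0 y0.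
have le z : 0 <= z -> z <= x + y -> z `^ q <= z * (x + y) `^ (q - 1).
  move=> z0 zxy; rewrite -[leLHS](mulr_powRB1 z0 q0).
  by apply: ler_wpM2l => //; apply: ge0_ler_powR; rewrite ?nnegrE ?subr_ge0.
rewrite -[leRHS](mulr_powRB1 xy0 q0) mulrDl.
by apply: lerD; apply: le => //; rewrite ?lerDl ?lerDr.
Qed.

Lemma powR_midpoint (x y q : R) : 0 <= x -> 0 <= y -> 1 <= q ->
  (2^-1 * (x + y)) `^ q <= 2^-1 * (x `^ q + y `^ q).
Proof.
move=> x0 y0 q1; rewrite !mulrDr {2 4}(_ : 2^-1 = 1 - 2^-1); last first.
  by rewrite {2}(splitr 1) div1r addrK.
by apply: (convex_powR q1 (Itv01 _ _)) => //=;
  rewrite ?inE/= ?in_itv/= ?andbT// ?invr_ge0// invf_le1 ?ler1n.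
Qed.

Lemma dotp_ge0 n (x : 'rV[R]_n) : 0 <= dotp x x.
Proof. by apply: sumr_ge0 => i _; rewrite -expr2 sqr_ge0. Qed.

Lemma enorm_powR n (x : 'rV[R]_n) p : enorm x `^ p = dotp x x `^ (2^-1 * p).
Proof. by rewrite powRrM powR12_sqrt// dotp_ge0. Qed.

Lemma enorm_eq0 n (x : 'rV[R]_n) : enorm x = 0 -> x = 0.
Proof.
move=> /eqP; rewrite sqrtr_eq0 => x0; apply/rowP => i; rewrite mxE.
apply/eqP; rewrite -sqrf_eq0 eq_le sqr_ge0 andbT.
exact: le_trans (coord_le_dotp x i) x0.
Qed.

Lemma dotpZ n (c : R) (x : 'rV[R]_n) : dotp (c *: x) (c *: x) = c ^+ 2 * dotp x x.
Proof. by rewrite /dotp mulr_sumr; apply: eq_bigr => i _; rewrite !mxE; ring. Qed.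

Lemma dotp_orthogonal n (M : 'M[R]_n) (x : 'rV[R]_n) : M *m M^T = 1%:M ->
  dotp (x *m M) (x *m M) = dotp x x.
Proof. by move=> MM; rewrite !dotp_mulmx trmx_mul mulmxA -(mulmxA x) MM mulmx1. Qed.

Lemma parallelogram n (x y : 'rV[R]_n) :
  dotp (2^-1 *: (x + y)) (2^-1 *: (x + y)) +
  dotp (2^-1 *: (x - y)) (2^-1 *: (x - y)) = 2^-1 * (dotp x x + dotp y y).
Proof.
rewrite /dotp -!big_split mulr_sumr; apply: eq_bigr => i _ /=.
by rewrite !mxE; field.
Qed.

(** With [q = p/2 >= 1] and squared norms as arguments: superadditivity joins the two terms on the
    left, the parallelogram law evaluates the sum, and convexity splits it. *)
Lemma clarkson n (x y : 'rV[R]_n) p : 2 <= p ->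
  enorm (2^-1 *: (x + y)) `^ p + enorm (2^-1 *: (x - y)) `^ p <=
  2^-1 * (enorm x `^ p + enorm y `^ p).
Proof.
move=> p2; rewrite !enorm_powR.
have q1 : 1 <= 2^-1 * p by rewrite ler_pdivlMl// mulr1.
apply: (le_trans (powR_superadditive (dotp_ge0 _) (dotp_ge0 _) q1)).
by rewrite parallelogram powR_midpoint// dotp_ge0.
Qed.

End clarkson.

Section energy.
Context {R : realType} {n : nat}.
Variable p : R.
Local Notation mu := (lebesgue_rV n).
Implicit Types G H : 'rV[R]_n -> 'rV[R]_n.
Local Open Scope ereal_scope.

Definition energy G : \bar R := \int[mu]_x (enorm (G x) `^ p)%:E.

Lemma energy_density_ge0 (y : 'rV[R]_n) : 0 <= (enorm y `^ p)%:E.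
Proof. by rewrite lee_fin powR_ge0. Qed.

Lemma energy_ge0 G : 0 <= energy G.
Proof. by apply: integral_ge0 => x _; exact: energy_density_ge0. Qed.

Lemma measurable_enorm_powR G : measurable_fun setT G ->
  measurable_fun setT (fun x => (enorm (G x) `^ p)%:E).
Proof.
move=> mG; apply/measurable_EFinP; under eq_fun do rewrite enorm_powR.
apply: (measurableT_comp (measurable_powR _)).
exact: (measurableT_comp (@measurable_dotp R n) mG).
Qed.

Lemma Lnorm_energy G : 'N[mu]_p%:E[EFin \o enorm \o G] = energy G `^ p^-1.
Proof.
rewrite unlock; congr (_ `^ _); apply: eq_integral => x _ /=.
by rewrite ger0_norm// sqrtr_ge0.
Qed.

Lemma energy_Lnorm G : p != 0%R ->
  energy G = 'N[mu]_p%:E[EFin \o enorm \o G] `^ p.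
Proof.
by move=> p0; rewrite Lnorm_energy -poweRrM mulVf// poweRe1// energy_ge0.
Qed.

Lemma measurable_lincomb (a b : R) G H : measurable_fun setT G ->
  measurable_fun setT H ->
  measurable_fun setT (fun x => (a *: G x + b *: H x)%R).
Proof.
move=> mG mH; apply: measurable_fun_rV => i.
under eq_fun do rewrite !mxE.
by apply: measurable_funD; apply: measurable_funM => //;
  exact: (measurableT_comp (measurable_coord i)).
Qed.

Lemma measurable_half_sum G H : measurable_fun setT G ->
  measurable_fun setT H ->
  measurable_fun setT (fun x => 2^-1 *: (G x + H x))%R.
Proof.
by move=> mG mH; under eq_fun do rewrite scalerDr; exact: measurable_lincomb.
Qed.

Lemma measurable_half_diff G H : measurable_fun setT G ->
  measurable_fun setT H ->
  measurable_fun setT (fun x => 2^-1 *: (G x - H x))%R.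
Proof.
move=> mG mH; under eq_fun do rewrite scalerDr scalerN -scaleNr.
exact: measurable_lincomb.
Qed.

Lemma energy_clarkson G H : (2 <= p)%R ->
  measurable_fun setT G -> measurable_fun setT H ->
  energy G < +oo -> energy H = energy G ->
  energy (fun x => 2^-1 *: (G x + H x))%R +
  energy (fun x => 2^-1 *: (G x - H x))%R <= energy G.
Proof.
move=> p2 mG mH Goo HG.
have m1 := measurable_half_sum mG mH; have m2 := measurable_half_diff mG mH.
have Gfin : energy G \is a fin_num by rewrite (ge0_fin_numE (energy_ge0 G)).
rewrite -(ge0_integralD _ measurableT (fun x _ => energy_density_ge0 _)
  (measurable_enorm_powR m1) (fun x _ => energy_density_ge0 _)
  (measurable_enorm_powR m2)).
have -> : energy G =
    \int[mu]_x (2^-1%:E * ((enorm (G x) `^ p)%:E + (enorm (H x) `^ p)%:E)).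
  have sum0 x : setT x -> 0 <= (enorm (G x) `^ p)%:E + (enorm (H x) `^ p)%:E.
    by move=> _; apply: adde_ge0; exact: energy_density_ge0.
  have msum := emeasurable_funD (measurable_enorm_powR mG) (measurable_enorm_powR mH).
  rewrite (ge0_integralZl mu measurableT msum sum0); last by rewrite lee_fin.
  rewrite (ge0_integralD _ measurableT (fun x _ => energy_density_ge0 _)
    (measurable_enorm_powR mG) (fun x _ => energy_density_ge0 _)
    (measurable_enorm_powR mH)).
  rewrite -/(energy G) -/(energy H) HG -(fineK Gfin) -EFinD -EFinM.
  by congr EFin; field.
apply: (ge0_le_integral _ measurableT).
- by move=> x _; apply: adde_ge0; exact: energy_density_ge0.
- by apply: emeasurable_funD; exact: measurable_enorm_powR.
- by apply: measurable_funeM; apply: emeasurable_funD; exact: measurable_enorm_powR.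
by move=> x _; rewrite -!EFinD -EFinM lee_fin clarkson.
Qed.

(** Clarkson and the last hypothesis give [energy G + energy ((G - H)/2) <= energy G]; as [energy G]
    is finite it cancels, and the half difference has energy 0. *)
Lemma energy_minimizers_ae_eq G H : (2 <= p)%R ->
  measurable_fun setT G -> measurable_fun setT H ->
  energy G < +oo -> energy H = energy G ->
  energy G <= energy (fun x => 2^-1 *: (G x + H x))%R ->
  {ae mu, forall x, G x = H x}.
Proof.
move=> p2 mG mH Goo HG Gmid; have m2 := measurable_half_diff mG mH.
have Gfin : energy G \is a fin_num by rewrite (ge0_fin_numE (energy_ge0 G)).
have le1 := energy_clarkson p2 mG mH Goo HG.
have le2 : energy (fun x => 2^-1 *: (G x - H x))%R <= 0.
  rewrite -(leeD2lE _ _ Gfin) adde0; apply: le_trans le1.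
  by rewrite leeD2r.
have /eqP : energy (fun x => 2^-1 *: (G x - H x))%R == 0.
  by rewrite eq_le le2 energy_ge0.
have -> : energy (fun x => 2^-1 *: (G x - H x))%R =
    \int[mu]_x `|(enorm (2^-1 *: (G x - H x)) `^ p)%:E|.
  by apply: eq_integral => x _; rewrite (gee0_abs (energy_density_ge0 _)).
move=> /(ae_eq_integral_abs mu measurableT (measurable_enorm_powR m2)).
apply: filterS => x /(_ I) [] /powR_eq0_eq0 /enorm_eq0 /eqP.
by rewrite scaler_eq0 invr_eq0 pnatr_eq0/= subr_eq0 => /eqP.
Qed.

End energy.

(** * Symmetry of Morrey extremals *)

Section symmetry.
Context {R : realType} {n : nat}.
Variables (p : R) (u : 'rV[R]_n.+1 -> R).
Local Notation mu := (lebesgue_rV n.+1).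
Local Notation e := (@e_last R n).

Lemma weak_gradient_measurable (v : 'rV[R]_n.+1 -> R) G :
  weak_gradient v G -> measurable_fun setT G.
Proof. by move=> vG; apply: measurable_fun_rV => i; have [_ []] := vG i. Qed.

Lemma weak_gradient_lincomb (a b : R) (v w : 'rV[R]_n.+1 -> R) G H :
  weak_gradient v G -> weak_gradient w H ->
  weak_gradient (fun x => a * v x + b * w x) (fun x => a *: G x + b *: H x).
Proof.
move=> vG wH i; have := weak_partial_lincomb a b (vG i) (wH i).
by congr weak_partial; apply/funext => x; rewrite !mxE.
Qed.

(** Each coordinate of [G] is bounded by its Euclidean norm. This admits the averaged competitor to
    Morrey's inequality. *)
Lemma D1p_of_energy (v : 'rV[R]_n.+1 -> R) G : 0 < p -> continuous v ->
  weak_gradient v G -> (energy p G < +oo)%E -> D1p p v.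
Proof.
move=> p0 cv vG Goo; split => //; exists G => // i.
have mG := weak_gradient_measurable vG.
have mGi : measurable_fun setT (fun x => G x ord0 i).
  exact: (measurableT_comp (measurable_coord i) mG).
apply/andP; split; first exact/mem_set.
apply/mem_set; rewrite /finite_norm unlock; apply: poweR_lty.
apply: le_lt_trans Goo; apply: (ge0_le_integral _ measurableT).
- by move=> x _; exact: poweR_ge0.
- rewrite (_ : (fun x => _) = (fun x => (`|G x ord0 i| `^ p)%:E))//.
  apply/measurable_EFinP; apply: (measurableT_comp (measurable_powR _)).
  exact: measurableT_comp mGi.
- exact: measurable_enorm_powR.
move=> x _ /=; rewrite lee_fin ge0_ler_powR ?nnegrE ?sqrtr_ge0 ?(ltW p0)//.
by rewrite -sqrtr_sqr ler_wsqrtr// coord_le_dotp.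
Qed.

Lemma holder_quotientE (v : 'rV[R]_n.+1 -> R) x y (a b : R) :
  v x = a -> v y = b ->
  holder_quotient p v x y = `|a - b| / enorm (x - y) `^ (1 - n.+1%:R / p).
Proof. by move=> <- <-. Qed.

Lemma poles_neq : e != - e.
Proof.
apply/eqP => /rowP/(_ ord_max); rewrite !mxE !eqxx/= => /eqP.
by rewrite -subr_eq0 opprK -natrD pnatr_eq0.
Qed.

Lemma pole_distance_gt0 : 0 < enorm (e - - e).
Proof.
rewrite /enorm sqrtr_gt0 (lt_le_trans _ (coord_le_dotp _ ord_max))//.
by rewrite exprn_even_gt0//= !mxE !eqxx/= opprK -natrD pnatr_eq0.
Qed.

Hypothesis p_ge2 : 2 <= p.
Hypothesis extremal_u : morrey_extremal p u.
Hypothesis poles_u : holder_seminorm p u = (holder_quotient p u e (- e))%:E.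
Hypotheses (ue : u e = 1) (uNe : u (- e) = -1).

(** Both claims are instances: [s = 1] with [M] fixing the poles, and [s = -1] with [M] exchanging
    them. *)
Lemma extremal_symmetry (s : R) (M : 'M[R]_n.+1) : s ^+ 2 = 1 ->
  M *m M^T = 1%:M -> s * u (e *m M) = 1 -> s * u (- e *m M) = -1 ->
  forall x, u x = s * u (x *m M).
Proof.
move=> s1 MM ve vNe.
have p0 : 0 < p by rewrite (lt_le_trans _ p_ge2).
have [[cu _] _ [C [G [[morreyC _] uG uCG]]]] := extremal_u.
pose K x := s *: (G (x *m M) *m M^T).
have uMG := weak_gradient_mulmx MM uG.
have mG := weak_gradient_measurable uG.
have mK : measurable_fun setT K.
  have := weak_gradient_measurable (weak_gradient_lincomb s 0 uMG uMG).
  by congr measurable_fun; apply/funext => x; rewrite scale0r addr0.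
have cv : continuous (fun x : 'rV[R]_n.+1 => u (x *m M)).
  exact: continuous_comp_mulmx.
have KG : energy p K = energy p G.
  have := ge0_integral_preserving (@measurable_rV_mulmx R n.+1 M)
    (fun A => @lebesgue_rV_orthogonal _ _ M A MM) (measurable_enorm_powR p mG)
    (fun x => energy_density_ge0 p _).
  rewrite -/(energy p G) => <-; apply: eq_integral => x _.
  have MM' : M^T *m M^T^T = 1%:M by rewrite trmxK; exact: mulmx1C.
  by rewrite /enorm /K dotpZ s1 mul1r dotp_orthogonal.
pose w x := 2^-1 * u x + (2^-1 * s) * u (x *m M).
pose W x := 2^-1 *: (G x + K x).
have wW : weak_gradient w W.
  have := weak_gradient_lincomb 2^-1 (2^-1 * s) uG uMG.
  by congr weak_gradient; apply/funext => x; rewrite /W /K scalerDr scalerA.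
have cw : continuous w.
  exact: (@class_CD _ _ 0 _ _ (@class_CM _ _ 0 _ _ (class_C_cst 0 _) cu)
    (@class_CM _ _ 0 _ _ (class_C_cst 0 _) cv)).
pose S := holder_quotient p u e (- e).
have S0 : 0 < S.
  have -> : S = _ := holder_quotientE ue uNe.
  apply: divr_gt0; last exact: powR_gt0 pole_distance_gt0.
  by rewrite opprK normr_gt0 -[1 + 1]/(2%:R) pnatr_eq0.
have wS : (S%:E <= holder_seminorm p w)%E.
  apply: ereal_sup_ubound; exists (e, - e) => /=; first exact: poles_neq.
  have wE x (a : R) : u x = a -> s * u (x *m M) = a -> w x = a.
    by rewrite /w -mulrA => -> ->; field.
  have -> : S = _ := holder_quotientE ue uNe.
  have hw := holder_quotientE (wE _ _ ue ve) (wE _ _ uNe vNe).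
  by congr EFin; exact: hw.
set NG := 'N[mu]_p%:E[EFin \o enorm \o G]%E in uCG.
have CNG : (C%:E * NG = S%:E)%E by rewrite -uCG poles_u.
have NG0 : (0 <= NG)%E by exact: Lnorm_ge0.
(* The product [C * NG] is the positive real [S]. Hence [C] cannot be nonpositive and [NG] cannot be
   infinite; later [C] is cancelled and the energy is finite. *)
have C0 : 0 < C.
  rewrite ltNge; apply/negP => C0.
  have : (C%:E * NG <= 0)%E by rewrite mule_le0_ge0 ?lee_fin.
  by rewrite CNG lee_fin leNgt S0.
have NGoo : (NG < +oo)%E.
  rewrite ltey; apply/eqP => NGy; move: CNG.
  by rewrite NGy gt0_muley ?lte_fin.
have pn0 : p != 0 by rewrite gt_eqF.
have Goo : (energy p G < +oo)%E by rewrite (energy_Lnorm G pn0) (poweR_lty _ NGoo).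
have m1 : measurable_fun setT W by exact: weak_gradient_measurable wW.
(* Needed to place [w] in [D1p]; it is Clarkson with the half difference dropped. *)
have Woo : (energy p W < +oo)%E.
  apply: le_lt_trans (Goo); apply: le_trans (energy_clarkson p_ge2 mG mK Goo KG).
  exact: (leeDl (energy p W) (energy_ge0 p _)).
have NGW : (NG <= 'N[mu]_p%:E[EFin \o enorm \o W])%E.
  have C0e : (0 < C%:E)%E by rewrite lte_fin.
  apply: (etrans (esym (lee_pmul2l (erefl : C%:E \is a fin_num) C0e _ _)) _).
  apply: (@le_trans _ _ (holder_seminorm p w)); first by rewrite CNG.
  exact: morreyC (D1p_of_energy p0 cw wW Woo) wW.
have GW : (energy p G <= energy p W)%E.
  rewrite (energy_Lnorm G pn0) (energy_Lnorm W pn0).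
  apply: gt0_ler_poweR (ltW p0) _ _ _ _ NGW.
  - by rewrite in_itv/= NG0 leey.
  - by rewrite in_itv/= Lnorm_ge0 leey.
have GK := energy_minimizers_ae_eq p_ge2 mG mK Goo KG GW.
pose d x := 1 * u x + (- s) * u (x *m M).
have dGK : weak_gradient d (fun x => 1 *: G x + (- s) *: (G (x *m M) *m M^T)).
  exact: weak_gradient_lincomb.
have cd : continuous d.
  exact: (@class_CD _ _ 0 _ _ (@class_CM _ _ 0 _ _ (class_C_cst 0 _) cu)
    (@class_CM _ _ 0 _ _ (class_C_cst 0 _) cv)).
(* The weak derivative of [d] is the matching coordinate of [G - K], null almost everywhere. *)
have d0 i phi : test_function phi ->
    (\int[mu]_x (d x * partial i phi x)%:E = 0)%E.
  move=> tphi; have [_ lD wd] := dGK i; apply: etrans (wd _ tphi) _.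
  have /integrableP[mD _] := integrable_test lD tphi.
  apply: etrans (congr1 oppe _) (@oppe0 R).
  apply: etrans (integral0 mu setT).
  apply: (@ae_eq_integral _ _ R mu setT (cst 0%E) _ measurableT mD).
    exact: measurable_cst.
  apply: filterS GK => x GKx _ /=.
  by rewrite scale1r scaleNr -/(K x) GKx subrr mxE mul0r.
have dE x : d x = u x - s * u (x *m M) by rewrite /d mul1r mulNr.
have de : d e = 0 by apply: etrans (dE e) _; apply/eqP; rewrite subr_eq0 ue ve.
move=> x; apply/eqP; rewrite -subr_eq0 -dE -de; apply/eqP.
exact: weak_gradient0_cst.
Qed.

End symmetry.

(** The entries of [M *m M^T] are the inner products of the rows of [M], which are the images of the
    basis vectors. *)
Lemma orthogonal_transformation_mx (R : realType) (n : nat)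
  (O : {linear 'rV[R]_n -> 'rV[R]_n}) : orthogonal_transformation O ->
  exists2 M : 'M[R]_n, M *m M^T = 1%:M & forall x, O x = x *m M.
Proof.
move=> orthO; have OE x : O x = x *m lin1_mx O by rewrite mul_rV_lin1.
exists (lin1_mx O) => //; apply/matrixP => i j.
have := orthO (delta_mx 0 i) (delta_mx 0 j).
rewrite !OE -!rowE [RHS]dotp_mulmx trmx_delta mul_delta_mx_cond => MM.
transitivity (dotp (row i (lin1_mx O)) (row j (lin1_mx O))).
  by rewrite mxE; apply: eq_bigr => k _; rewrite !mxE.
by rewrite MM mulmxnE !mxE eqxx.
Qed.

(** The matrix is [1 - 2 P] with [P] the projection onto the last axis; it is symmetric, and
    [P *m P = P] makes it an involution. *)
Lemma reflection_mx (R : realType) (n : nat) :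
  exists2 M : 'M[R]_n.+1, M *m M^T = 1%:M &
    forall x, x *m M = x - (2 * x ord0 ord_max) *: e_last.
Proof.
pose P : 'M[R]_n.+1 := delta_mx ord_max ord_max.
have PP : P *m P = P by rewrite mul_delta_mx.
have PT : (2 *: P)^T = 2 *: P by apply/matrixP => i j; rewrite !mxE andbC.
exists (1%:M - 2 *: P).
  rewrite linearB/= trmx1 PT mulmxBl mul1mx mulmxBr mulmx1.
  rewrite -scalemxAl -scalemxAr PP.
  by apply/matrixP => i j; rewrite !mxE; ring.
move=> x; rewrite mulmxBr mulmx1 -scalemxAr -scalerA; congr (_ - _ *: _).
apply/rowP => j; rewrite !mxE (bigD1 ord_max)//= big1 ?addr0.
  by rewrite !mxE eqxx.
by move=> i /negbTE im; rewrite mxE im mulr0.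
Qed.

(* The dimension is n.+1, so that ord_max is the last coordinate. *)
Theorem theorem1p1 (R : realType) (n : nat) (p : R) (u : 'rV[R]_n.+1 -> R) :
  (2 <= n.+1)%N -> n.+1%:R < p ->
  morrey_extremal p u ->
  holder_seminorm p u = (holder_quotient p u e_last (- e_last))%:E ->
  u e_last = 1 -> u (- e_last) = -1 ->
  (forall O : {linear 'rV[R]_n.+1 -> 'rV[R]_n.+1},
     orthogonal_transformation O -> O e_last = e_last -> forall x, u (O x) = u x) /\
  (forall x : 'rV[R]_n.+1, u (x - (2 * x ord0 ord_max) *: e_last) = - u x).
Proof.
move=> n2 np extu polu ue uNe.
have p2 : 2 <= p by rewrite (le_trans _ (ltW np))// ler_nat.
split=> [ O /orthogonal_transformation_mx[M MM OM] Oe|x].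
  have eM : e_last *m M = e_last by rewrite -OM.
  have h1 : 1 * u (e_last *m M) = 1 by rewrite mul1r eM.
  have h2 : 1 * u (- e_last *m M) = -1 by rewrite mul1r mulNmx eM.
  move=> x.
  rewrite OM [RHS](extremal_symmetry p2 extu polu ue uNe (expr1n R 2) MM h1 h2).
  by rewrite mul1r.
have [M MM MT] := reflection_mx R n.
have eM : e_last *m M = - e_last.
  by rewrite MT mxE !eqxx mulr1 scaler_nat mulr2n opprD addNKr.
have h1 : -1 * u (e_last *m M) = 1 by rewrite eM uNe mulN1r opprK.
have h2 : -1 * u (- e_last *m M) = -1 by rewrite mulNmx eM opprK ue mulN1r.
have s1 : (-1) ^+ 2 = 1 :> R by rewrite sqrrN expr1n.
by rewrite (extremal_symmetry p2 extu polu ue uNe s1 MM h1 h2 x) MT mulN1r opprK.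
Qed.
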